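(* Let $\ell$ be a dominant Lyndon word such that the first letter of $\ell$ occurs exactly once in $\ell$, and let $\ell=\ell_1i$ (with $i\in I$ a single letter) be its costandard factorization. If $p_{|\ell_1|,\alpha_i}=0$, then $$(R_\ell,\bar R_\ell)=\big((\omega'_{|\ell_1|},\omega_i)^{-1}-(\omega'_i,\omega_{|\ell_1|})\big)\,(R_{\ell_1},\bar R_{\ell_1}).$$
   Context: For $\alpha,\beta\in\Phi^+$, $p_{\alpha,\beta}=\max\{k\ge0\mid\alpha-k\beta\in\Phi\}$. Root data. $\Phi$ is the irreducible reduced root system of a finite-dimensional complex simple Lie algebra, with positive roots $\Phi^+$, ordered simple roots $\alpha_1,\dots,\alpha_n$, inner product $(\cdot,\cdot)$ normalized so that short roots have square length $2$, $a_{ij}=2(\alpha_i,\alpha_j)/(\alpha_i,\alpha_i)$, $d_i=(\alpha_i,\alpha_i)/2$, root lattice $Q$. Let $\langle\cdot,\cdot\rangle$ be the bilinear form on $Q$ with $\langle\alpha_i,\alpha_j\rangle=d_ia_{ij}$ if $i<j$, $d_i$ if $i=j$, $0$ if $i>j$, except that in type $D_n$ (with $\alpha_i=\varepsilon_i-\varepsilon_{i+1}$ for $i<n$, $\alpha_n=\varepsilon_{n-1}+\varepsilon_n$) one sets $\langle\alpha_{n-1},\alpha_n\rangle=-1$, $\langle\alpha_n,\alpha_{n-1}\rangle=1$. Let $r,s$ be indeterminates. For $\lambda,\mu\in Q$ put $(\omega'_\lambda,\omega_\mu)=r^{\langle\lambda,\mu\rangle}s^{-\langle\mu,\lambda\rangle}\in\mathbb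 C(r,s)$, with index $i$ standing for $\alpha_i$. Shuffle algebra. Let $I=\{1,\dots,n\}$, $\mathcal W$ the set of words in $I$, $\mathcal F$ the $\mathbb C(r,s)$-vector space with basis $\mathcal W$, graded by $|[i_1\dots i_d]|=\alpha_{i_1}+\dots+\alpha_{i_d}$. The shuffle product $*$ is defined inductively by $\emptyset*x=x*\emptyset=x$ and $(xi)*(yj)=(x*(yj))i+(\omega'_{|xi|},\omega_j)^{-1}((xi)*y)j$ for $i,j\in I$, homogeneous $x,y$; it is associative. $\mathcal U\subset\mathcal F$ is the subalgebra of $(\mathcal F,* )$ generated by $I$. The bar involution on $\mathcal F$ is the additive map, semilinear with respect to the automorphism $r\leftrightarrow s$ of $\mathbb C(r,s)$ over $\mathbb C$, with $\overline{[i_1\dots i_d]}=\big(\prod_{k<l}(\omega'_{i_l},\omega_{i_k})^{-1}\big)[i_d\dots i_1]$; it is a ring automorphism of $(\mathcal F,* )$ preserving $\mathcal U$. Pairing. Let $\Delta:\mathcal F\to\mathcal F\otimes\mathcal F$ be the linear map $\Delta([i_1\dots i_d])=\sum_{0\le k\le d}[i_{k+1}\dots i_d]\otimes[i_1\dots i_k]$; it satisfies $\Delta(\mathcal U)\subset\mathcal U\otimes\mathcal U$. $(\cdot,\cdot):\mathcal U\times\mathcal U\to\mathbb C(r,s)$ is the unique bilinear form (it exists and is symmetric and non-degenerate) with $(1,1)=1$, $(i,j)=\delta_{ij}$ for $i,j\in I$, $(x,y)=0$ if $x,y$ are homogeneous with $|x|\ne|y|$, $(x,y*z)=(\Delta(x),z\otimes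 y)$ and $(x*y,z)=(y\otimes x,\Delta(z))$, where $(x'\otimes x'',y'\otimes y'')=(x',y')(x'',y'')$. Words. Fix an arbitrary total order on $I$ and order $\mathcal W$ lexicographically (a proper prefix is smaller). A word is dominant if it is the largest word occurring with nonzero coefficient in some nonzero element of $\mathcal U$. A nonempty word is Lyndon if it is strictly smaller than each of its proper nonempty right factors. The set of dominant Lyndon words is denoted $\mathcal L^+$; $w\mapsto|w|$ is a bijection $\mathcal L^+\to\Phi^+$. The costandard factorization of a Lyndon word $w$ of length $\ge2$ is $w=w_1w_2$ with $w_1,w_2$ nonempty, $w_1$ Lyndon of maximal possible length (then $w_2$ is Lyndon; both are dominant if $w$ is). If the first letter of a Lyndon word occurs exactly once in it, the right factor $w_2$ is a single letter. Elements $R_\ell$. $R_i=i$ for $i\in I$, and $R_w=R_{w_1}*R_{w_2}-(\omega'_{|w_2|},\omega_{|w_1|})R_{w_2}*R_{w_1}$ if $w=w_1w_2$ is the costandard factorization of the Lyndon word $w$; $\bar R_w=\overline{R_w}$. *)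

(* Defs.v *)
From HB Require Import structures.
From mathcomp Require Import all_boot all_order all_algebra perm.
From mathcomp Require Import generic_quotient finmap polyXY fraction reals complex.
From mathcomp.multinomials Require Import monalg.

Set Implicit Arguments.
Unset Strict Implicit.
Unset Printing Implicit Defensive.

Import Order.TTheory GRing.Theory Num.Theory.
Local Open Scope ring_scope.

(* A root system is given in the coordinates of its ordered simple roots: the
   root lattice Q is 'rV[int]_n, the i-th simple root is the i-th unit vector
   (indices start at 0), and the inner product is given by its Gram matrix G on
   the simple roots.  With short roots of square length 2 every root of an
   irreducible Phi has square length 2, 4 or 6, so G has integer entries. *)
Section RootSystems.
Variable n : nat.
Local Notation Q := 'rV[int]_n.

Definition alpha (i : 'I_n) : Q := delta_mx 0 i.

Section Gram.
Variable G : 'M[int]_n.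

Definition dot (x y : Q) : int := \sum_i \sum_j x 0 i * G i j * y 0 j.

Definition dvd_cartan (a b : Q) : bool := (dot a a %| 2 * dot a b)%Z.

Definition reflection (a b : Q) : Q := b - (2 * dot a b %/ dot a a)%Z *: a.

Record is_root_system (Phi : {fset Q}) : Prop := IsRootSystem {
  gram_sym : G^T = G;
  gram_posdef : forall x : Q, x != 0 -> 0 < dot x x;
  root_neq0 : (0 : Q) \notin Phi;
  root_crystallographic : {in Phi &, forall a b, dvd_cartan a b};
  root_reflection : {in Phi &, forall a b, reflection a b \in Phi};
  root_reduced : {in Phi &, forall (a b : Q) (p q : int),
    q != 0 -> q *: b = p *: a -> b = a \/ b = - a};
  root_irreducible : Phi != fset0 /\
    forall A B : {fset Q}, Phi = (A `|` B)%fset ->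
      (forall a b, a \in A -> b \in B -> dot a b = 0) ->
      A = fset0 \/ B = fset0;
  root_simple : forall i, alpha i \in Phi;
  root_base : {in Phi, forall a : Q,
    (forall i, 0 <= a 0 i) \/ (forall i, a 0 i <= 0)};
  root_short : (exists2 a, a \in Phi & dot a a = 2) /\
    {in Phi, forall a, 2 <= dot a a}
}.

Definition cartan (i j : 'I_n) : int :=
  (2 * dot (alpha i) (alpha j) %/ dot (alpha i) (alpha i))%Z.

Definition dnum (i : 'I_n) : int := (dot (alpha i) (alpha i) %/ 2)%Z.

End Gram.

(* The roots e_i - e_(i+1), ..., e_(n-1) + e_n of type D_n in an orthonormal
   basis (e_k), and their Gram matrix. *)
Definition simple_D : 'M[int]_n := \matrix_(i, k)
  if (i.+1 < n)%N then (k == i)%:R - (k == i.+1 :> nat)%:R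
  else (k.+2 == n)%:R + (k.+1 == n)%:R.

Definition gram_D : 'M[int]_n := simple_D *m simple_D^T.

Definition type_D (G : 'M[int]_n) : Prop :=
  (4 <= n)%N /\
  exists s : 'S_n, forall i j, G i j = gram_D (s i) (s j).

(* In type D_n the simple roots are numbered as in simple_D. *)
Definition standard_order_D (G : 'M[int]_n) : Prop := type_D G -> G = gram_D.

Definition euler_simple (G : 'M[int]_n) (i j : 'I_n) : int :=
  let D := (4 <= n)%N && (G == gram_D) in
  if [&& D, i.+2 == n & j.+1 == n] then -1
  else if [&& D, i.+1 == n & j.+2 == n] then 1
  else if (i < j)%N then dnum G i * cartan G i j
  else if i == j then dnum G i
  else 0.

Definition euler (G : 'M[int]_n) (x y : Q) : int :=
  \sum_i \sum_j x 0 i * euler_simple G i j * y 0 j.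

(* p_(a,b) = k *)
Definition is_string_length (Phi : {fset Q}) (a b : Q) (k : nat) : Prop :=
  a - b *+ k \in Phi /\ forall m : nat, a - b *+ m \in Phi -> (m <= k)%N.

End RootSystems.

Section Scalars.
Variable R : realType.
Local Notation "x %:F" := (FracField.tofrac x).

(* C(r,s), where r is the inner and s the outer variable of C[r][s]. *)
Definition scalars : fieldType := {fraction {poly {poly R[i]}}}.

Definition rvar : scalars := (('X : {poly R[i]})%:P)%:F.
Definition svar : scalars := ('X : {poly {poly R[i]}})%:F.

(* The automorphism exchanging r and s; see swap_rsE. *)
Definition swap_rs (f : scalars) : scalars :=
  let g := repr (f : {fraction {poly {poly R[i]}}}) in
  (swapXY \n_g)%:F / (swapXY \d_g)%:F.

Lemma frac_repr (D : idomainType) (p q : D) : q != 0 ->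
  let g := repr (p%:F / q%:F) in p * \d_g = \n_g * q.
Proof.
move=> q0; set f := _ / _ => g.
have E : f * (\d_g)%:F = (\n_g)%:F.
  unlock FracField.tofrac; rewrite -{1}[f]reprK -[LHS]FracField.pi_mul.
  apply/eqmodP; rewrite /= FracField.equivfE /FracField.mulf /=.
  by rewrite !numden_Ratio ?oner_neq0 ?mulr1 ?denom_ratioP // mulrC.
apply/eqP; rewrite -tofrac_eq !tofracM -E /f; apply/eqP.
by rewrite [RHS]mulrAC divfK // tofrac_eq0.
Qed.

Lemma swap_rsE (p q : {poly {poly R[i]}}) : q != 0 ->
  swap_rs (p%:F / q%:F) = (swapXY p)%:F / (swapXY q)%:F.
Proof.
move=> q0; have := frac_repr p q0; rewrite /swap_rs /=.
set g := repr _ => E; have d0 : \d_g != 0 by exact: denom_ratioP.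
have F0 (u : {poly {poly R[i]}}) : u != 0 -> (swapXY u)%:F != 0 :> scalars.
  by move=> u0; rewrite -[0]/(0%:F) tofrac_eq swapXY_eq0.
apply/eqP; rewrite eqr_div ?F0 //; apply/eqP.
rewrite -[LHS]/((swapXY \n_g)%:F * (swapXY q)%:F : {fraction _}).
rewrite -[RHS]/((swapXY p)%:F * (swapXY \d_g)%:F : {fraction _}).
by rewrite -!tofracM -!rmorphM E.
Qed.

(* (omega'_x, omega_y) *)
Definition omega_pair (n : nat) (G : 'M[int]_n) (x y : 'rV[int]_n) : scalars :=
  rvar ^ euler G x y * svar ^ (- euler G y x).

End Scalars.

(* I = 'I_n, words are sequences over 'I_n, K is the field of scalars, chi x y
   stands for (omega'_x, omega_y), and sigma for the automorphism of K used in
   the bar involution. *)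
Section Words.
Variable n : nat.

Definition wt (w : seq 'I_n) : 'rV[int]_n := \sum_(i <- w) alpha i.

Lemma wt_rev (w : seq 'I_n) : wt (rev w) = wt w.
Proof. exact: big_rev. Qed.

Section Order.
Variable leI : rel 'I_n.

Definition total_order : Prop :=
  [/\ total leI, antisymmetric leI & transitive leI].

Fixpoint lex_lt (u v : seq 'I_n) : bool :=
  match u, v with
  | _, [::] => false
  | [::], _ :: _ => true
  | i :: u', j :: v' =>
      (i != j) && leI i j || (i == j) && lex_lt u' v'
  end.

Definition lyndon (w : seq 'I_n) : bool :=
  (w != [::]) && [forall k : 'I_(size w), (0 < k)%N ==> lex_lt w (drop k w)].

(* For a Lyndon word of length at least 2. *)
Definition costandard (w : seq 'I_n) : seq 'I_n * seq 'I_n :=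
  let k := (\max_(k < size w | lyndon (take k w)) k)%N in
  (take k w, drop k w).

End Order.

Section Shuffle.
Variables (K : fieldType) (chi : 'rV[int]_n -> 'rV[int]_n -> K).
Local Notation F := {malg K[seq 'I_n]}.
Local Notation F2 := {malg K[(seq 'I_n * seq 'I_n)%type]}.

Definition wd (w : seq 'I_n) : F := << w >>.

Definition lin_ext (T : choiceType) (V : lmodType K) (f : T -> V)
    (x : {malg K[T]}) : V := \sum_(w <- msupp x) x@_w *: f w.

Lemma lin_ext_basis (T : choiceType) (V : lmodType K) (f : T -> V) (w : T) :
  lin_ext f << w >> = f w.
Proof.
rewrite /lin_ext msuppU oner_eq0 big_seq_fset1.
by rewrite mcoeffUU scale1r.
Qed.

Definition append (i : 'I_n) : F -> F := lin_ext (fun w => wd (rcons w i)).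

(* The product of two words that are both read from right to left. *)
Fixpoint shuffle_rev (u : seq 'I_n) : seq 'I_n -> F :=
  match u with
  | [::] => fun v => wd (rev v)
  | i :: u' => fix aux (v : seq 'I_n) : F :=
      match v with
      | [::] => wd (rev u)
      | j :: v' => append i (shuffle_rev u' v)
                   + (chi (wt u) (alpha j))^-1 *: append j (aux v')
      end
  end.

Definition shuffle (x y : F) : F :=
  lin_ext (fun u => lin_ext (fun v => shuffle_rev (rev u) (rev v)) y) x.

Lemma shuffle_rcons (x y : seq 'I_n) (i j : 'I_n) :
  shuffle (wd (rcons x i)) (wd (rcons y j)) =
    append i (shuffle (wd x) (wd (rcons y j)))
    + (chi (wt (rcons x i)) (alpha j))^-1
        *: append j (shuffle (wd (rcons x i)) (wd y)).
Proof.
rewrite /shuffle /wd !lin_ext_basis !rev_rcons /= rev_cons revK.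
by have -> : wt (i :: rev x) = wt (rcons x i) by rewrite -rev_rcons wt_rev.
Qed.

(* The subalgebra generated by the letters. *)
Inductive inU : F -> Prop :=
  | inU_one : inU (wd [::])
  | inU_letter (i : 'I_n) : inU (wd [:: i])
  | inU_scale (c : K) (x : F) : inU x -> inU (c *: x)
  | inU_add (x y : F) : inU x -> inU y -> inU (x + y)
  | inU_shuffle (x y : F) : inU x -> inU y -> inU (shuffle x y).

Definition dominant (leI : rel 'I_n) (w : seq 'I_n) : Prop :=
  exists2 x : F, inU x &
    w \in msupp x /\ forall v, v \in msupp x -> v != w -> lex_lt leI v w.

Definition bar_coef (w : seq 'I_n) : K :=
  \prod_(l < size w) \prod_(k < size w | (k < l)%N)
    (chi (alpha (tnth (in_tuple w) l)) (alpha (tnth (in_tuple w) k)))^-1.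

Definition bar (sigma : K -> K) (x : F) : F :=
  \sum_(w <- msupp x) (sigma x@_w * bar_coef w) *: wd (rev w).

(* F (x) F has basis the pairs of words. *)
Definition tensor (x y : F) : F2 :=
  lin_ext (fun u => lin_ext (fun v => << (u, v) >> : F2) y) x.

Definition Delta : F -> F2 :=
  lin_ext (fun w => \sum_(k < (size w).+1) (<< (drop k w, take k w) >> : F2)).

Definition homogeneous (a : 'rV[int]_n) (x : F) : Prop :=
  forall w, w \in msupp x -> wt w = a.

Definition in_UU (t : seq (F * F)) : Prop :=
  forall p, p \in t -> inU p.1 /\ inU p.2.

(* Only the values of B on U x U are constrained.  An element of U (x) U is
   given by a family t of pairs of elements of U, as the sum of the p.1 (x) p.2
   over p in t. *)
Record is_pairing (B : F -> F -> K) : Prop := IsPairing {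
  pairing_linear_l : forall (c : K) (x y z : F), inU x -> inU y -> inU z ->
    B (c *: x + y) z = c * B x z + B y z;
  pairing_linear_r : forall (c : K) (x y z : F), inU x -> inU y -> inU z ->
    B z (c *: x + y) = c * B z x + B z y;
  pairing_one : B (wd [::]) (wd [::]) = 1;
  pairing_letters : forall i j : 'I_n, B (wd [:: i]) (wd [:: j]) = (i == j)%:R;
  pairing_graded : forall (a b : 'rV[int]_n) (x y : F), inU x -> inU y ->
    homogeneous a x -> homogeneous b y -> a != b -> B x y = 0;
  pairing_shuffle_r : forall (x y z : F) (t : seq (F * F)),
    inU x -> inU y -> inU z ->
    in_UU t -> Delta x = \sum_(p <- t) tensor p.1 p.2 ->
    B x (shuffle y z) = \sum_(p <- t) B p.1 z * B p.2 y;
  pairing_shuffle_l : forall (x y z : F) (t : seq (F * F)),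
    inU x -> inU y -> inU z ->
    in_UU t -> Delta z = \sum_(p <- t) tensor p.1 p.2 ->
    B (shuffle x y) z = \sum_(p <- t) B y p.1 * B x p.2
}.

(* The first argument bounds the depth of the recursion; see Rw_letter and
   Rw_costandard. *)
Fixpoint Rw_rec (leI : rel 'I_n) (m : nat) (w : seq 'I_n) : F :=
  match m with
  | 0 => wd w
  | m'.+1 =>
      if (size w <= 1)%N then wd w else
      let: (w1, w2) := costandard leI w in
      shuffle (Rw_rec leI m' w1) (Rw_rec leI m' w2)
      - chi (wt w2) (wt w1) *: shuffle (Rw_rec leI m' w2) (Rw_rec leI m' w1)
  end.

Definition Rw (leI : rel 'I_n) (w : seq 'I_n) : F := Rw_rec leI (size w) w.

Lemma Rw_letter (leI : rel 'I_n) (i : 'I_n) : Rw leI [:: i] = wd [:: i].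
Proof. by []. Qed.

Lemma Rw_costandard (leI : rel 'I_n) (w : seq 'I_n) : (1 < size w)%N ->
  let: (w1, w2) := costandard leI w in
  Rw leI w = shuffle (Rw leI w1) (Rw leI w2)
             - chi (wt w2) (wt w1) *: shuffle (Rw leI w2) (Rw leI w1).
Proof.
have costd_size v : (1 < size v)%N ->
    let: (v1, v2) := costandard leI v in
    (size v1 < size v)%N /\ (size v2 < size v)%N.
  move=> hv; rewrite /costandard; set k := (\max_(_ < _ | _) _)%N.
  have kv : (k < size v)%N.
    by rewrite -(prednK (ltnW hv)) ltnS; apply/bigmax_leqP => j _;
      rewrite -ltnS (prednK (ltnW hv)).
  have k0 : (0 < k)%N.
    apply: (leq_trans _ (leq_bigmax_cond (Ordinal hv) _)) => //=.
    case: v hv {k kv} => [|a v] //= _.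
    by rewrite /lyndon /=; apply/forallP => -[[|j] hj] //=; rewrite take0 in hj.
  by rewrite size_take_min size_drop (minn_idPl (ltnW kv)) ltn_subrL k0 kv ltnW.
have fuel m1 m2 v : (size v <= m1)%N -> (size v <= m2)%N ->
    Rw_rec leI m1 v = Rw_rec leI m2 v.
  elim: m1 m2 v => [|m1 IH] [|m2] v h1 h2 /=; first by [].
  - by rewrite (leq_trans h1).
  - by rewrite (leq_trans h2).
  case: ltnP => hv; last by [].
  have le1 (u : seq 'I_n) m : (size u < size v)%N -> (size v <= m.+1)%N -> (size u <= m)%N.
    by move=> hu hm; rewrite -ltnS; apply: leq_trans hu hm.
  have := costd_size v hv; rewrite /costandard => -[lt1 lt2].
  rewrite (IH m2 (take _ v) (le1 _ _ lt1 h1) (le1 _ _ lt1 h2)).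
  by rewrite (IH m2 (drop _ v) (le1 _ _ lt2 h1) (le1 _ _ lt2 h2)).
move=> hw; have := costd_size w hw; rewrite /costandard => -[lt1 lt2].
have le1 (u : seq 'I_n) : (size u < size w)%N -> (size u <= (size w).-1)%N.
  by rewrite -{1}(prednK (ltnW hw)).
rewrite {1}/Rw -{1}(prednK (ltnW hw)) /= leqNgt hw /=.
rewrite (fuel _ _ (take _ w) (le1 _ lt1) (leqnn _)).
by rewrite (fuel _ _ (drop _ w) (le1 _ lt2) (leqnn _)).
Qed.

End Shuffle.
End Words.

(* Main.v *)
(* Write [d_k] for the deletion of a final letter [k], [d'_k] for that of an
   initial one ([delr], [dell]), and put
     ad_i x = x * i - (omega'_i, omega_|x|) i * x.
   If the first letter [a] of [l] occurs only once, every prefix of [l] is Lyndon,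
   so [R_l] is obtained from [a] by applying the [ad_i] along the other letters.
   The pairing makes [x |-> x * i] adjoint to [d_i] and [x |-> i * x] adjoint to
   [d'_i].  Moreover [d'_i] kills [R_l] for [i <> a], and
     d_j ad_i = ad_i d_j + delta_ij ((omega'_|x|, omega_i)^-1 - (omega'_i, omega_|x|)),
   which gives the formula as soon as [d_i R_l1 = 0].

   Now [d_i R_l1] has weight [|l1| - alpha_i], which is not a root.  The operators
   [ad_i] and [d_i] with [i <> a] satisfy the relations of [U_q(sl_2)]; a word
   starting with [a] and of length at least 2 is detected by the [d_i], and [ad_i]
   is a skew derivation, locally nilpotent by the quantum Serre relation.  Thus the
   weights that occur are stable under those reflections that lower the height, and
   induction on the height shows that they are roots. *)
From HB Require Import structures.
Require Import Defs.
From mathcomp Require Import all_boot all_order all_algebra.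
From mathcomp Require Import ring zify.
From mathcomp Require Import generic_quotient finmap polyXY fraction reals complex.
From mathcomp.multinomials Require Import monalg.

Set Implicit Arguments.
Unset Strict Implicit.
Unset Printing Implicit Defensive.

Import Order.TTheory GRing.Theory Num.Theory.
Local Open Scope ring_scope.

(** * Linear extension of maps from a basis *)

Section LinExt.
Variables (K : fieldType) (T : choiceType).
Implicit Types x y : {malg K[T]}.

Lemma malg_lin_ind (P : {malg K[T]} -> Prop) :
  P 0 -> (forall c w x, P x -> P (c *: << w >> + x)) -> forall x, P x.
Proof.
move=> P0 PS x; rewrite [x]monalgE.
elim: (enum_fset _) => [|w s IH]; first by rewrite big_nil.
rewrite big_cons; have -> : << x@_w *g w >> = x@_w *: << w >> :> {malg K[T]}.
  by apply/malgP => v; rewrite mcoeffZ !mcoeffU mulrnAr mulr1.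
exact: PS.
Qed.

(** Widening the sum to a finite set containing the support lets vectors with different supports
    share one range. *)
Lemma lin_extEw (V : lmodType K) (f : T -> V) x (d : {fset T}) :
  (msupp x `<=` d)%fset -> lin_ext f x = \sum_(w <- d) x@_w *: f w.
Proof.
move=> le; rewrite /lin_ext (big_fset_incl _ le) // => w _ wx.
by rewrite mcoeff_outdom // scale0r.
Qed.

Lemma lin_ext_linear (V : lmodType K) (f : T -> V) : linear (lin_ext f).
Proof.
move=> c x y; pose d := (msupp x `|` msupp y)%fset.
have lx : (msupp x `<=` d)%fset by exact: fsubsetUl.
have ly : (msupp y `<=` d)%fset by exact: fsubsetUr.
have lz : (msupp (c *: x + y) `<=` d)%fset.
  apply: (fsubset_trans (msuppD_le _ _)); apply: fsetSU; exact: msuppZ_le.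
rewrite !(lin_extEw f lx, lin_extEw f ly, lin_extEw f lz) scaler_sumr -big_split /=.
by apply: eq_bigr => w _; rewrite mcoeffD mcoeffZ scalerDl scalerA.
Qed.

Lemma lin_ext0 (V : lmodType K) (f : T -> V) : lin_ext f 0 = 0.
Proof. by rewrite /lin_ext msupp0 big_nil. Qed.

Lemma lin_extP (V : lmodType K) (f : T -> V) c x y :
  lin_ext f (c *: x + y) = c *: lin_ext f x + lin_ext f y.
Proof. exact: lin_ext_linear. Qed.

End LinExt.

Lemma lin_ext2_linear (K : fieldType) (T S : choiceType) (V : lmodType K)
    (f : T -> S -> V) (x : {malg K[T]}) :
  linear (fun y : {malg K[S]} => lin_ext (fun u => lin_ext (f u) y) x).
Proof.
move=> c y z; elim/malg_lin_ind: x => [|d u x IH].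
  by rewrite !lin_ext0 scaler0 addr0.
rewrite !lin_extP IH !lin_ext_basis lin_extP !scalerDr !scalerA [d * c]mulrC.
by rewrite addrACA.
Qed.

Section LinExtInstance.
Variables (K : fieldType) (T : choiceType).
Implicit Types x y : {malg K[T]}.

HB.instance Definition _ (V : lmodType K) (f : T -> V) :=
  GRing.isLinear.Build K {malg K[T]} V *:%R (lin_ext f) (lin_ext_linear f).

Lemma malg_neq0 x : x != 0 -> exists w, w \in msupp x.
Proof.
move=> x0; apply/fset0Pn; apply: contraNneq x0 => s0.
by rewrite [x]monalgE s0 big_nil.
Qed.

Lemma lin_ext_coef (S : choiceType) (f : T -> {malg K[S]}) x (v : S) :
  (lin_ext f x)@_v = \sum_(w <- msupp x) x@_w * (f w)@_v.
Proof. by rewrite /lin_ext raddf_sum; apply: eq_bigr => w _; rewrite /= mcoeffZ. Qed.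

End LinExtInstance.

(** * The shuffle algebra *)

(* The locks keep unification from unfolding the operators down to finite maps. *)
HB.lock Definition word n (K : fieldType) (w : seq 'I_n) : {malg K[seq 'I_n]} := wd K w.

HB.lock Definition sh n (K : fieldType) (chi : 'rV[int]_n -> 'rV[int]_n -> K)
  (x y : {malg K[seq 'I_n]}) : {malg K[seq 'I_n]} := shuffle chi x y.

HB.lock Definition delr n (K : fieldType) (k : 'I_n) (x : {malg K[seq 'I_n]}) :
    {malg K[seq 'I_n]} :=
  lin_ext (fun w => if rev w is j :: v then (j == k)%:R *: word K (rev v) else 0) x.

HB.lock Definition dell n (K : fieldType) (k : 'I_n) (x : {malg K[seq 'I_n]}) :
    {malg K[seq 'I_n]} :=
  lin_ext (fun w => if w is j :: v then (j == k)%:R *: word K v else 0) x.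

(** With [f] a character of the weight, these operators play the part of the torus of the quantum
    group. *)
HB.lock Definition diag n (K : fieldType) (f : seq 'I_n -> K)
    (x : {malg K[seq 'I_n]}) : {malg K[seq 'I_n]} :=
  lin_ext (fun w => f w *: word K w) x.

(** Putting the scalar into a diagonal operator makes this linear on all vectors, homogeneous or
    not. *)
HB.lock Definition ad n (K : fieldType) (chi : 'rV[int]_n -> 'rV[int]_n -> K) (i : 'I_n)
    (x : {malg K[seq 'I_n]}) : {malg K[seq 'I_n]} :=
  sh chi x (word K [:: i])
  - sh chi (word K [:: i]) (diag (fun w => chi (alpha i) (wt w)) x).

Section Shuffle.
Variables (n : nat) (K : fieldType) (chi : 'rV[int]_n -> 'rV[int]_n -> K).
Hypothesis chiDl : forall a b c, chi (a + b) c = chi a c * chi b c.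
Hypothesis chiDr : forall a b c, chi a (b + c) = chi a b * chi a c.
Hypothesis chi_neq0 : forall a b, chi a b != 0.
Local Notation W := (seq 'I_n).
Local Notation F := {malg K[W]}.
Local Notation wd := (@word n K).
Implicit Types (x y z : F) (u v w : W) (i j k : 'I_n) (f : W -> K).

Lemma chi0l a : chi 0 a = 1.
Proof. by apply: (mulfI (chi_neq0 0 a)); rewrite -chiDl addr0 mulr1. Qed.

Lemma chi0r a : chi a 0 = 1.
Proof. by apply: (mulfI (chi_neq0 a 0)); rewrite -chiDr addr0 mulr1. Qed.

Lemma alphaE i j : alpha i 0 j = (i == j)%:R.
Proof. by rewrite /alpha mxE eqxx eq_sym. Qed.

Lemma wt_nil : wt [::] = 0 :> 'rV_n. Proof. exact: big_nil. Qed.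

Lemma wt_cons i w : wt (i :: w) = alpha i + wt w. Proof. exact: big_cons. Qed.

Lemma wt_letter i : wt [:: i] = alpha i. Proof. exact: big_seq1. Qed.

Lemma wt_cat u v : wt (u ++ v) = wt u + wt v. Proof. exact: big_cat. Qed.

Lemma wt_rcons w i : wt (rcons w i) = wt w + alpha i.
Proof. by rewrite -cats1 wt_cat wt_letter. Qed.

Lemma wordE w : Defs.wd K w = wd w.
Proof. by rewrite word.unlock. Qed.

Lemma wdE w v : (wd w)@_v = (w == v)%:R.
Proof. by rewrite -wordE mcoeffU. Qed.

Lemma word_ind (P : F -> Prop) :
  P 0 -> (forall c w x, P x -> P (c *: wd w + x)) -> forall x, P x.
Proof. by move=> P0 PS; apply: malg_lin_ind => // c w x; rewrite -/(Defs.wd K w) wordE; apply: PS. Qed.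

Lemma lin_ext_wd (V : lmodType K) (g : W -> V) w : lin_ext g (wd w) = g w.
Proof. by rewrite -wordE lin_ext_basis. Qed.

Local Notation "x ** y" := (sh chi x y) (at level 40, left associativity).

Lemma shE x y : x ** y = shuffle chi x y.
Proof. by rewrite sh.unlock. Qed.

Lemma sh_linear_r x : linear (sh chi x).
Proof. by move=> c y z; rewrite !shE; exact: lin_ext2_linear. Qed.

Lemma sh_linear_l y : linear ((sh chi)^~ y).
Proof. by move=> c x z; rewrite !shE; exact: lin_ext_linear. Qed.

HB.instance Definition _ x :=
  GRing.isLinear.Build K F F *:%R (sh chi x) (sh_linear_r x).

Lemma shDl x y z : (x + y) ** z = x ** z + y ** z.
Proof. by rewrite -[x]scale1r sh_linear_l !scale1r. Qed.

Lemma shDr x y z : x ** (y + z) = x ** y + x ** z.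
Proof. exact: linearD. Qed.

Lemma sh0l x : 0 ** x = 0.
Proof. by rewrite shE; exact: lin_ext0. Qed.

Lemma sh0r x : x ** 0 = 0.
Proof. exact: linear0. Qed.

Lemma shZl c x y : (c *: x) ** y = c *: (x ** y).
Proof. by have := sh_linear_l y c x 0; rewrite sh0l !addr0. Qed.

Lemma shBl x y z : (x - y) ** z = x ** z - y ** z.
Proof. by rewrite shDl -scaleN1r shZl scaleN1r. Qed.

Lemma shBr x y z : x ** (y - z) = x ** y - x ** z.
Proof. exact: linearB. Qed.

Lemma shZr c x y : x ** (c *: y) = c *: (x ** y).
Proof. exact: linearZ. Qed.

Lemma bilinear_ext (f g : F -> F -> F) :
  (forall y, linear (f^~ y)) -> (forall x, linear (f x)) ->
  (forall y, linear (g^~ y)) -> (forall x, linear (g x)) ->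
  (forall u v, f (wd u) (wd v) = g (wd u) (wd v)) -> forall x y, f x y = g x y.
Proof.
have lin0 (h : F -> F) : linear h -> h 0 = 0.
  by move=> lh; have := lh (-1) 0 0; rewrite scaler0 addr0 scaleN1r addNr.
move=> fl fr gl gr fg x y.
elim/word_ind: x => [|c u x IH].
  by rewrite (lin0 _ (fl y)) (lin0 _ (gl y)).
have E : f (wd u) y = g (wd u) y; last by rewrite fl gl IH E.
elim/word_ind: y {IH} => [|d v y IH]; first by rewrite (lin0 _ (fr _)) (lin0 _ (gr _)).
by rewrite fr gr IH fg.
Qed.

Lemma delr_is_linear k : linear (delr k : F -> F).
Proof. by move=> c x y; rewrite delr.unlock lin_extP. Qed.

Lemma dell_is_linear k : linear (dell k : F -> F).
Proof. by move=> c x y; rewrite dell.unlock lin_extP. Qed.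

Lemma diag_is_linear f : linear (diag f).
Proof. by move=> c x y; rewrite diag.unlock lin_extP. Qed.

HB.instance Definition _ k :=
  GRing.isLinear.Build K F F *:%R (delr k : F -> F) (delr_is_linear k).
HB.instance Definition _ k :=
  GRing.isLinear.Build K F F *:%R (dell k : F -> F) (dell_is_linear k).
HB.instance Definition _ f :=
  GRing.isLinear.Build K F F *:%R (diag f) (diag_is_linear f).

Lemma delrE k x w : (delr k x)@_w = x@_(rcons w k).
Proof.
elim/word_ind: x => [|c v x IH]; first by rewrite linear0 !mcoeff0.
rewrite linearP /= !mcoeffD !mcoeffZ IH; congr (_ * _ + _).
rewrite delr.unlock lin_ext_wd wdE.
case/lastP: v => [|v j]; first by rewrite mcoeff0; case: w {IH}.
by rewrite rev_rcons mcoeffZ wdE revK -natrM mulnb eqseq_rcons andbC.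
Qed.

Lemma dellE k x w : (dell k x)@_w = x@_(k :: w).
Proof.
elim/word_ind: x => [|c v x IH]; first by rewrite linear0 !mcoeff0.
rewrite linearP /= !mcoeffD !mcoeffZ IH; congr (_ * _ + _).
rewrite dell.unlock lin_ext_wd wdE.
case: v => [|j v]; first by rewrite mcoeff0.
by rewrite mcoeffZ wdE -natrM mulnb eqseq_cons.
Qed.

Lemma diagE f x w : (diag f x)@_w = f w * x@_w.
Proof.
elim/word_ind: x => [|c v x IH]; first by rewrite linear0 !mcoeff0 mulr0.
rewrite linearP /= !mcoeffD !mcoeffZ IH mulrDr; congr (_ + _).
rewrite diag.unlock lin_ext_wd mcoeffZ wdE.
by have [->|_] := eqVneq v w; rewrite ?mulr0 // !mulr1 mulrC.
Qed.

Lemma diag_wd f w : diag f (wd w) = f w *: wd w.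
Proof. by rewrite diag.unlock lin_ext_wd. Qed.

Lemma eq_delr x y : x@_[::] = y@_[::] -> (forall k, delr k x = delr k y) -> x = y.
Proof.
move=> e0 eD; apply/malgP => w; case/lastP: w => [|w k] //.
by rewrite -!delrE eD.
Qed.

Lemma delr_wd_nil k : delr k (wd [::]) = 0.
Proof. by rewrite delr.unlock lin_ext_wd. Qed.

Lemma delr_wd_rcons k w j : delr k (wd (rcons w j)) = (j == k)%:R *: wd w.
Proof. by rewrite delr.unlock lin_ext_wd rev_rcons revK. Qed.

Lemma delr_letter k j : delr k (wd [:: j]) = (j == k)%:R *: wd [::].
Proof. exact: (delr_wd_rcons k [::] j). Qed.

(** [tr k] carries the scalar of the shuffle recursion, [tl k] its analogue for initial letters, and
    [sl k], the twist in [ad], is the inverse of [tl k]. *)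
Definition tr k : F -> F := diag (fun w => (chi (wt w) (alpha k))^-1).
Definition tl k : F -> F := diag (fun w => (chi (alpha k) (wt w))^-1).
Definition sl k : F -> F := diag (fun w => chi (alpha k) (wt w)).

HB.instance Definition _ k := GRing.Linear.on (tr k).
HB.instance Definition _ k := GRing.Linear.on (tl k).
HB.instance Definition _ k := GRing.Linear.on (sl k).

HB.instance Definition _ j := GRing.Linear.on (append j : F -> F).

Lemma sh1l y : wd [::] ** y = y.
Proof.
elim/word_ind: y => [|c v y IH]; first exact: linear0.
have E : wd [::] ** wd v = wd v.
  by rewrite shE /shuffle !lin_ext_wd /= wordE revK.
by rewrite linearP /= IH E.
Qed.

Lemma sh1r x : x ** wd [::] = x.
Proof.
elim/word_ind: x => [|c v x IH]; first exact: sh0l.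
have E : wd v ** wd [::] = wd v.
  rewrite shE /shuffle !lin_ext_wd /=.
  by case: (rev v) (revK v) => [|j u] <-; rewrite /= wordE.
by rewrite shDl shZl IH E.
Qed.

Lemma delr_append k j x : delr k (append j x) = (j == k)%:R *: x.
Proof.
elim/word_ind: x => [|c v x IH]; first by rewrite !linear0 ?scaler0.
have E : delr k (append j (wd v)) = (j == k)%:R *: wd v.
  by rewrite /append lin_ext_wd wordE delr_wd_rcons.
by rewrite !linearP /= IH E.
Qed.

Lemma append_coef0 j x : (append j x)@_[::] = 0.
Proof.
rewrite /append lin_ext_coef big1 // => w _.
by rewrite wordE wdE -size_eq0 size_rcons mulr0.
Qed.

Lemma delrP k c x y : delr k (c *: x + y) = c *: delr k x + delr k y.
Proof. exact: linearP. Qed.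

Lemma trP k c x y : tr k (c *: x + y) = c *: tr k x + tr k y.
Proof. exact: linearP. Qed.

Lemma trE k x w : (tr k x)@_w = (chi (wt w) (alpha k))^-1 * x@_w.
Proof. exact: diagE. Qed.

Lemma tlE k x w : (tl k x)@_w = (chi (alpha k) (wt w))^-1 * x@_w.
Proof. exact: diagE. Qed.

Lemma slE k x w : (sl k x)@_w = chi (alpha k) (wt w) * x@_w.
Proof. exact: diagE. Qed.

Lemma tr_wd k w : tr k (wd w) = (chi (wt w) (alpha k))^-1 *: wd w.
Proof. exact: diag_wd. Qed.

Lemma tr1 k : tr k (wd [::]) = wd [::].
Proof. by rewrite tr_wd wt_nil chi0l invr1 scale1r. Qed.

(** The shuffle recursion read through the last letter: it comes from [x], or from [y] at the cost
    of the scalar in [tr k]. *)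
Lemma delr_mul k x y : delr k (x ** y) = delr k x ** y + tr k x ** delr k y.
Proof.
apply: (bilinear_ext (f := fun x y => delr k (x ** y))
  (g := fun x y => delr k x ** y + tr k x ** delr k y)) => {x y}.
- by move=> y c x z; rewrite shDl shZl delrP.
- by move=> x c y z; rewrite shDr shZr delrP.
- move=> y c x z; rewrite delrP trP !shDl !shZl scalerDr.
  by rewrite addrACA.
- move=> x c y z; rewrite delrP !shDr !shZr scalerDr.
  by rewrite addrACA.
move=> u v; case/lastP: u => [|u i].
  by rewrite tr1 !sh1l delr_wd_nil sh0l add0r.
case/lastP: v => [|v j]; first by rewrite !sh1r delr_wd_nil sh0r addr0.
have E : (chi (wt (rcons u i)) (alpha j))^-1 * (j == k)%:R =
    (j == k)%:R * (chi (wt (rcons u i)) (alpha k))^-1.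
  by have [->|_] := eqVneq j k; rewrite ?mulr0 ?mul0r // mulr1 mul1r.
rewrite shE -!wordE shuffle_rcons !wordE -!shE addrC delrP !delr_append !delr_wd_rcons addrC.
rewrite shZl shZr tr_wd shZl !scalerA.
by rewrite E [_%:R * _]mulrC.
Qed.

Lemma sh_coef0 x y : (x ** y)@_[::] = x@_[::] * y@_[::].
Proof.
elim/word_ind: x => [|c u x IH]; first by rewrite sh0l !mcoeff0 mul0r.
rewrite shDl shZl !mcoeffD !mcoeffZ mulrDl IH -mulrA; congr (_ * _ + _).
elim/word_ind: y {IH} => [|d v y IH]; first by rewrite sh0r !mcoeff0 mulr0.
rewrite shDr shZr !mcoeffD !mcoeffZ mulrDr IH mulrCA; congr (_ * _ + _).
case/lastP: u {IH} => [|u i]; first by rewrite sh1l !wdE mul1r.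
case/lastP: v => [|v j]; first by rewrite sh1r !wdE mulr1.
rewrite shE -!wordE shuffle_rcons !wordE -!shE mcoeffD mcoeffZ !append_coef0 mulr0 addr0 !wdE.
by rewrite -[rcons u i == _]size_eq0 size_rcons mul0r.
Qed.

(** Here [f] is a character of the free monoid; [diag f] commutes with [tr k], and with [delr k] up
    to the factor [f [:: k]], so induction on the last letter applies. *)
Lemma diag_mul (f : W -> K) : f [::] = 1 ->
  (forall w i, f (rcons w i) = f w * f [:: i]) ->
  forall x y, diag f (x ** y) = diag f x ** diag f y.
Proof.
move=> f1 fM x y; apply/malgP => w; rewrite diagE.
have delr_diag k z : delr k (diag f z) = f [:: k] *: diag f (delr k z).
  by apply/malgP => v; rewrite delrE mcoeffZ !diagE delrE fM -mulrA mulrCA.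
have tr_diag k z : tr k (diag f z) = diag f (tr k z).
  by apply/malgP => v; rewrite !diagE mulrCA.
elim/last_ind: w x y => [|w k IH] x y.
  by rewrite !sh_coef0 !diagE f1 !mul1r.
rewrite fM -!delrE !delr_mul !mcoeffD !delr_diag tr_diag shZl shZr.
by rewrite !mcoeffZ -!IH mulrDr; congr (_ + _); rewrite -mulrA mulrCA.
Qed.

Lemma tr_mul k x y : tr k (x ** y) = tr k x ** tr k y.
Proof.
apply: diag_mul => [|w i]; first by rewrite wt_nil chi0l invr1.
by rewrite wt_rcons wt_letter chiDl invfM.
Qed.

Lemma sl_mul k x y : sl k (x ** y) = sl k x ** sl k y.
Proof.
apply: diag_mul => [|w i]; first by rewrite wt_nil chi0r.
by rewrite wt_rcons wt_letter chiDr.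
Qed.

Lemma delr_tl k j x : delr k (tl j x) = (chi (alpha j) (alpha k))^-1 *: tl j (delr k x).
Proof.
apply/malgP => w; rewrite delrE mcoeffZ !tlE delrE wt_rcons chiDr invfM.
by rewrite -mulrA mulrCA.
Qed.

Lemma delr_sl k j x : delr k (sl j x) = chi (alpha j) (alpha k) *: sl j (delr k x).
Proof.
apply/malgP => w; rewrite delrE mcoeffZ !slE delrE wt_rcons chiDr.
by rewrite -mulrA mulrCA.
Qed.

Lemma dell_tr k j x : dell k (tr j x) = (chi (alpha k) (alpha j))^-1 *: tr j (dell k x).
Proof.
apply/malgP => w; rewrite dellE mcoeffZ !trE dellE wt_cons chiDl invfM.
by rewrite -mulrA.
Qed.

Lemma dell_delr k j x : dell k (delr j x) = delr j (dell k x).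
Proof. by apply/malgP => w; rewrite dellE !delrE dellE. Qed.

(** The twisted Leibniz rule expands both sides into the same three terms because [tr k] is
    multiplicative. *)
Lemma shA x y z : x ** y ** z = x ** (y ** z).
Proof.
apply/malgP => w; elim/last_ind: w x y z => [|w k IH] x y z.
  by rewrite !sh_coef0 mulrA.
rewrite -!delrE !delr_mul tr_mul shDl shDr !mcoeffD !IH.
by rewrite addrA.
Qed.

(** The recursion sees only last letters, so this rule for first letters is proved by induction on
    the last one; left and right deletions commute. *)
Lemma dell_mul k x y : dell k (x ** y) = dell k x ** tl k y + x ** dell k y.
Proof.
apply/malgP => w; elim/last_ind: w x y => [|w j IH] x y.
  rewrite dellE -[[:: k]]/(rcons [::] k) -delrE delr_mul !mcoeffD !sh_coef0.
  by rewrite !delrE !dellE trE tlE wt_nil chi0l chi0r invr1 !mul1r.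
rewrite -!delrE -dell_delr !delr_mul !linearD /= !delr_mul !mcoeffD !IH.
(* The mixed terms agree: [dell k] past [tr j] and [delr j] past [tl k] give the same scalar
   [(chi (alpha k) (alpha j))^-1]. *)
rewrite dell_tr !dell_delr delr_tl !shZl !shZr !mcoeffZ !mcoeffD.
by rewrite mcoeffZ addrACA.
Qed.

(** * Adjoint operators *)

Local Notation ad := (ad chi).

Lemma adE i x : ad i x = x ** wd [:: i] - wd [:: i] ** sl i x.
Proof. by rewrite ad.unlock. Qed.

Lemma ad_is_linear i : linear (ad i).
Proof.
move=> c x y; rewrite !adE linearP shDl shZl shDr shZr scalerBr opprD.
by rewrite addrACA.
Qed.

HB.instance Definition _ i :=
  GRing.isLinear.Build K F F *:%R (ad i) (ad_is_linear i).

Lemma sl_letter j i : sl j (wd [:: i]) = chi (alpha j) (alpha i) *: wd [:: i].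
Proof. by rewrite /sl diag_wd wt_letter. Qed.

Lemma slC i j x : sl i (sl j x) = sl j (sl i x).
Proof. by apply/malgP => w; rewrite !slE mulrCA. Qed.

(** The term [x ** wd [:: i] ** sl i y] is added and subtracted. *)
Lemma ad_mul i x y : ad i (x ** y) = x ** ad i y + ad i x ** sl i y.
Proof.
by rewrite !adE sl_mul shBr shBl !shA addrA subrK.
Qed.

Lemma sl_ad j i x : sl j (ad i x) = chi (alpha j) (alpha i) *: ad i (sl j x).
Proof.
by rewrite !adE linearB /= !sl_mul sl_letter slC shZl shZr -scalerBr.
Qed.

(** The scalar from [delr k] past [sl i] cancels that of [tr k] on the letter [i]; what remains is
    the correction from deleting the added letter, as in the [sl_2] commutator. *)
Lemma delr_ad k i x :
  delr k (ad i x) = ad i (delr k x) + (i == k)%:R *: (tr i x - sl i x).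
Proof.
rewrite !adE linearB /= !delr_mul !delr_letter tr_wd wt_letter delr_sl.
rewrite !shZl !shZr sh1r sh1l scalerA mulVf // scale1r.
have [->|_] := eqVneq i k; last by rewrite !scale0r add0r !addr0.
by rewrite !scale1r opprD [- _ - _]addrC addrACA.
Qed.

(** * Homogeneous vectors, where zero has every weight *)

Definition hom (a : 'rV[int]_n) x : bool := all (fun w => wt w == a) (msupp x).

Lemma hom_homogeneous a x : hom a x -> homogeneous a x.
Proof. by move=> /allP h w /h /eqP. Qed.

Lemma homP a x : hom a x <-> forall w, x@_w != 0 -> wt w = a.
Proof.
split=> [/hom_homogeneous h w|h]; first by rewrite mcoeff_neq0; exact: h.
by apply/allP => w; rewrite -mcoeff_neq0 => /h ->.
Qed.

Lemma hom_coef a x w : hom a x -> wt w != a -> x@_w = 0.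
Proof. by move/homP => h; apply: contra_neq_eq; exact: h. Qed.

Lemma hom_diag a x f c : hom a x -> (forall w, wt w = a -> f w = c) ->
  diag f x = c *: x.
Proof.
move=> h fc; apply/malgP => w; rewrite diagE mcoeffZ.
have [/fc ->//|/(hom_coef h) ->] := eqVneq (wt w) a.
by rewrite !mulr0.
Qed.

Lemma hom_tr a x k : hom a x -> tr k x = (chi a (alpha k))^-1 *: x.
Proof. by move=> h; apply: (hom_diag h) => w ->. Qed.

Lemma hom_sl a x k : hom a x -> sl k x = chi (alpha k) a *: x.
Proof. by move=> h; apply: (hom_diag h) => w ->. Qed.

Lemma hom_wd w : hom (wt w) (wd w).
Proof. by apply/homP => v; rewrite wdE; have [->|_] := eqVneq w v; rewrite ?eqxx. Qed.

Lemma hom_lin a c x y : hom a x -> hom a y -> hom a (c *: x + y).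
Proof.
move=> hx hy; apply/homP => w; apply: contra_neq_eq => wa.
by rewrite mcoeffD mcoeffZ (hom_coef hx wa) (hom_coef hy wa) mulr0 addr0.
Qed.

Lemma hom_delr a k x : hom a x -> hom (a - alpha k) (delr k x).
Proof.
move=> /homP h; apply/homP => w; rewrite delrE => /h <-.
by rewrite wt_rcons addrK.
Qed.

Lemma hom_mul a b x y : hom a x -> hom b y -> hom (a + b) (x ** y).
Proof.
move=> hx hy; apply/homP => w.
elim/last_ind: w a b x y hx hy => [|w k IH] a b x y hx hy.
  rewrite sh_coef0 mulf_eq0 negb_or => /andP[].
  by move=> /((homP _ _).1 hx) <- /((homP _ _).1 hy) <-; rewrite wt_nil addr0.
rewrite -delrE delr_mul mcoeffD; apply: contra_neq_eq => wk.
have wk' : wt w != a + b - alpha k by rewrite eq_sym subr_eq -wt_rcons eq_sym.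
rewrite (hom_tr _ hx) shZl mcoeffZ.
have -> : (delr k x ** y)@_w = 0.
  by apply/eqP/negP => /negP /(IH _ _ _ _ (hom_delr k hx) hy) e;
    rewrite e addrAC eqxx in wk'.
have -> : (x ** delr k y)@_w = 0.
  by apply/eqP/negP => /negP /(IH _ _ _ _ hx (hom_delr k hy)) e;
    rewrite e addrA eqxx in wk'.
by rewrite mulr0 addr0.
Qed.

Lemma hom_ad a i x : hom a x -> hom (a + alpha i) (ad i x).
Proof.
move=> hx.
have h1 : hom (a + alpha i) (x ** wd [:: i]).
  by have := hom_mul hx (hom_wd [:: i]); rewrite wt_letter.
have h2 : hom (a + alpha i) (wd [:: i] ** x).
  by have := hom_mul (hom_wd [:: i]) hx; rewrite wt_letter addrC.
have -> : ad i x = (- chi (alpha i) a) *: (wd [:: i] ** x) + x ** wd [:: i].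
  by rewrite adE (hom_sl _ hx) shZr scaleNr addrC.
exact: hom_lin.
Qed.

(** The scalar of the commutator of [delr i] and [ad i] on weight [a], and the factor in the final
    formula. *)
Definition cw i a : K := (chi a (alpha i))^-1 - chi (alpha i) a.

Lemma delr_ad_hom a i x : hom a x ->
  delr i (ad i x) = ad i (delr i x) + cw i a *: x.
Proof.
move=> hx; rewrite delr_ad eqxx scale1r (hom_tr _ hx) (hom_sl _ hx).
by rewrite -scalerBl.
Qed.

Lemma delr_ad_neq k i x : i != k -> delr k (ad i x) = ad i (delr k x).
Proof. by rewrite delr_ad => /negPf ->; rewrite scale0r addr0. Qed.

(** * Local nilpotency of [ad i] *)

Local Notation adn i N := (iter N (ad i)).

Lemma adn0 i N : adn i N 0 = 0.
Proof. by elim: N => //= N ->; rewrite linear0. Qed.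

Lemma adnD i N x y : adn i N (x + y) = adn i N x + adn i N y.
Proof. by elim: N => //= N ->; rewrite linearD. Qed.

Lemma adnZ i N c x : adn i N (c *: x) = c *: adn i N x.
Proof. by elim: N => //= N ->; rewrite linearZ. Qed.

Lemma adn_sl i N x : adn i N x = 0 -> adn i N (sl i x) = 0.
Proof.
have E : sl i (adn i N x) = chi (alpha i) (alpha i) ^+ N *: adn i N (sl i x).
  elim: N => [|N IH] /=; first by rewrite scale1r.
  by rewrite sl_ad IH linearZ /= scalerA exprS.
move=> x0; move/eqP: E; rewrite x0 linear0 eq_sym scaler_eq0 expf_eq0.
by rewrite (negPf (chi_neq0 _ _)) andbF => /eqP.
Qed.

(** By the skew Leibniz rule each application of [ad i] lowers one of the two exponents, whence the
    induction on their sum. *)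
Lemma adn_mul i N M x y : adn i N x = 0 -> adn i M y = 0 ->
  adn i (N + M) (x ** y) = 0.
Proof.
move: {2}(N + M)%N (erefl (N + M)%N) => m.
elim: m N M x y => [|m IH] [|N] M x y e hx hy.
- by rewrite [x]hx sh0l adn0.
- by [].
- by rewrite [x]hx sh0l adn0.
case: M e hy => [|M] e hy; first by rewrite [y]hy sh0r adn0.
rewrite addSn iterSr ad_mul adnD.
have -> : adn i (N + M.+1) (x ** ad i y) = 0.
  by rewrite addnS -addSn; apply: IH; rewrite -?iterSr //; lia.
rewrite add0r; apply: IH; rewrite -?iterSr //; first by lia.
exact: adn_sl.
Qed.

Lemma adn_le i N M x : (N <= M)%N -> adn i N x = 0 -> adn i M x = 0.
Proof. by move=> le e; rewrite -(subnK le) iterD e adn0. Qed.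

Definition adnil i x := exists N, adn i N x = 0.

Lemma adnil_lin i c x y : adnil i x -> adnil i y -> adnil i (c *: x + y).
Proof.
move=> [N hx] [M hy]; exists (N + M)%N.
by rewrite adnD adnZ (adn_le (leq_addr _ _) hx) (adn_le (leq_addl _ _) hy) scaler0 addr0.
Qed.

Lemma adnil_mul i x y : adnil i x -> adnil i y -> adnil i (x ** y).
Proof. by move=> [N hx] [M hy]; exists (N + M)%N; exact: adn_mul. Qed.

Lemma adnil_ad i x : adnil i x -> adnil i (ad i x).
Proof. by move=> [N hx]; exists N; rewrite -iterSr iterS hx linear0. Qed.

(** For [k = i] the commutator leaves a multiple of [x], so one more power of [ad i] suffices; for
    other letters the operators commute. *)
Lemma adnil_delr i k a x : hom a x -> adnil i x -> adnil i (delr k x).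
Proof.
move=> hx [N hN]; have [ik|ik] := eqVneq i k; last first.
  exists N; have -> : adn i N (delr k x) = delr k (adn i N x); last by rewrite hN linear0.
  by elim: N {hN} => //= N ->; rewrite delr_ad_neq.
rewrite -{k}ik; exists N.+1; elim: N a x hx hN => [|N IH] a x hx hN.
  by rewrite [x]hN linear0 adn0.
have hN' : adn i N (ad i x) = 0 by rewrite -iterSr.
rewrite iterSr; have -> : ad i (delr i x) = delr i (ad i x) - cw i a *: x.
  by rewrite (delr_ad_hom _ hx) addrK.
by rewrite adnD -scaleNr adnZ hN scaler0 addr0; exact: IH (hom_ad _ hx) hN'.
Qed.

(* The quantum Serre relation, in the form [ad i ^ (N + 1) (j) = 0] with
   [N = - a_ij]. *)
Lemma adnil_letter i j N : i != j ->
  chi (alpha j) (alpha i) * chi (alpha i) (alpha j) * chi (alpha i) (alpha i) ^+ N = 1 ->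
  adnil i (wd [:: j]).
Proof.
move=> ij uv; pose V m := adn i m (wd [:: j]); exists N.+1.
set q := chi (alpha i) (alpha i) in uv; set v := chi (alpha i) (alpha j) in uv.
have chin a m c : chi (a + alpha i *+ m) c = chi a c * chi (alpha i) c ^+ m.
  by elim: m => [|m IH]; rewrite ?addr0 ?mulr1 // mulrSr addrA chiDl IH exprSr mulrA.
have chin' a m c : chi c (a + alpha i *+ m) = chi c a * chi c (alpha i) ^+ m.
  by elim: m => [|m IH]; rewrite ?addr0 ?mulr1 // mulrSr addrA chiDr IH exprSr mulrA.
have hV m : hom (alpha j + alpha i *+ m) (V m).
  elim: m => [|m IH]; first by rewrite addr0 -wt_letter; exact: hom_wd.
  by rewrite mulrSr addrA; exact: hom_ad.
have dV m : delr i (V m.+1) = (\sum_(t < m.+1) cw i (alpha j + alpha i *+ t)) *: V m.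
  elim: m => [|m IH].
    rewrite big_ord1 [V _](_ : _ = ad i (V 0%N)) // (delr_ad_hom _ (hV 0%N)).
    by rewrite delr_letter eq_sym (negPf ij) scale0r linear0 add0r.
  rewrite [V m.+2](_ : _ = ad i (V m.+1)) // (delr_ad_hom _ (hV _)) IH linearZ /=.
  by rewrite -[ad i (V m)]/(V m.+1) -scalerDl [in RHS]big_ord_recr.
(* By [uv] the [t]-th scalar is [v * q ^+ (N - t) - v * q ^+ t], and reversing the index cancels the
   sum. *)
have S0 : \sum_(t < N.+1) cw i (alpha j + alpha i *+ t) = 0.
  have E (t : 'I_N.+1) : cw i (alpha j + alpha i *+ t) = v * q ^+ (N - t) - v * q ^+ t.
    rewrite /cw chin chin' -/q -/v; congr (_ - _).
    have le : (t <= N)%N by rewrite -ltnS.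
    have q0 : chi (alpha j) (alpha i) * q ^+ t != 0.
      by rewrite mulf_neq0 ?expf_neq0 // /q.
    apply: (mulIf q0); rewrite mulVf //; etransitivity; first exact: esym uv.
    rewrite -{1}(subnK le) exprD; ring.
  rewrite (eq_bigr _ (fun t _ => E t)) sumrB -!mulr_sumr -mulrBr.
  have -> : \sum_(t < N.+1) q ^+ (N - t) = \sum_(t < N.+1) q ^+ t.
    rewrite (reindex_inj rev_ord_inj); apply: eq_bigr => t _ /=.
    by rewrite subSS subKn // -ltnS.
  by rewrite subrr mulr0.
(* All deletions of [V N.+1] vanish: that of [i] by [S0]; that of any other letter commutes with
   [ad i] and leaves a multiple of the empty word, which [ad i] kills. *)
apply: eq_delr => [|k].
  rewrite mcoeff0; apply/eqP/negP => /negP /((homP _ _).1 (hV N.+1)).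
  move=> /rowP /(_ j); rewrite wt_nil mxE [in RHS]mxE mulmxnE !alphaE.
  by rewrite eqxx (negPf ij) mul0rn.
rewrite linear0; have [<-|ik] := eqVneq i k; first by rewrite dV S0 scale0r.
have dVk m : delr k (V m) = adn i m (delr k (wd [:: j])).
  by rewrite /V; elim: m => //= m IH; rewrite delr_ad_neq // IH.
rewrite -/(V N.+1) dVk delr_letter adnZ iterSr.
by rewrite adE sh1l /sl diag_wd wt_nil chi0r scale1r sh1r subrr adn0 scaler0.
Qed.

Lemma delrn_ad a i (k : nat) x : hom a x -> iter k (delr i) x = 0 ->
  iter k.+1 (delr i) (ad i x) = 0.
Proof.
elim: k a x => [|k IH] a x hx x0.
  by rewrite [x]x0 /= !linear0.
rewrite iterSr (delr_ad_hom _ hx).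
have iD m y z : iter m (delr i) (y + z) = iter m (delr i) y + iter m (delr i) z.
  by elim: m => //= m ->; rewrite linearD.
have iZ m c y : iter m (delr i) (c *: y) = c *: iter m (delr i) y.
  by elim: m => //= m ->; rewrite linearZ.
rewrite iD iZ x0 scaler0 addr0; apply: IH (hom_delr _ hx) _.
by rewrite -iterSr.
Qed.

(* As for [sl_2]: an [ad i]-nilpotent vector of weight [k >= 0] is not killed by
   lowering [k] times. *)
Lemma delrn_inj a i (k : nat) x : hom a x ->
  (forall m, (0 < m)%N -> chi (alpha i) (alpha i) ^+ m != 1) ->
  chi a (alpha i) * chi (alpha i) a = chi (alpha i) (alpha i) ^+ k ->
  adnil i x -> iter k (delr i) x = 0 -> x = 0.
Proof.
move=> hx hq hk [N hN] hF; elim: N a k x hx hk hN hF => [|N IH] a k x hx hk hN hF //.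
set q := chi (alpha i) (alpha i) in hq hk.
have q0 : q != 0 by exact: chi_neq0.
(* [ad i x] has [sl_2]-weight [k + 2], a smaller nilpotency exponent, and is killed already by
   [k + 1] deletions, so the induction hypothesis applies to it. *)
have Ex0 : ad i x = 0.
  have hk' : chi (a + alpha i) (alpha i) * chi (alpha i) (a + alpha i) = q ^+ k.+2.
    by rewrite chiDl chiDr -/q mulrACA hk mulrA -!exprSr.
  apply: (IH _ _ _ (hom_ad i hx) hk'); first by rewrite -iterSr.
  by rewrite iterS (delrn_ad hx hF) linear0.
have hF' m : hom (a - alpha i *+ m) (iter m (delr i) x).
  elim: m => [|m IHm]; first by rewrite subr0.
  by rewrite mulrSr opprD addrA; exact: hom_delr.
(* Raising undoes one lowering up to the accumulated commutator scalar [C], which factors into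
   geometric terms and is nonzero because [q] is not a root of unity. *)
pose C m : K := \sum_(t < m) cw i (a - alpha i *+ t).
have EF m : ad i (iter m.+1 (delr i) x) = - C m.+1 *: iter m (delr i) x.
  elim: m => [|m IHm].
    rewrite /C big_ord1 mulr0n subr0 scaleNr; apply/eqP; rewrite -addr_eq0 /=.
    by rewrite -(delr_ad_hom _ hx) Ex0 linear0.
  have e := delr_ad_hom i (hF' m.+1); rewrite IHm linearZ /= in e.
  apply: (addIr (cw i (a - alpha i *+ m.+1) *: iter m.+1 (delr i) x)).
  rewrite -[LHS]e /C [in RHS]big_ord_recr /= opprD scalerDl.
  by rewrite [(- cw _ _) *: _]scaleNr subrK.
have vK : (chi a (alpha i))^-1 = chi (alpha i) a * q ^- k.
  apply: (mulfI (chi_neq0 a (alpha i))); rewrite mulrA hk !mulfV // expf_neq0 //.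
have chiN (b c : 'rV[int]_n) t : chi (b - alpha i *+ t) c = chi b c * chi (alpha i) c ^- t.
  apply: (mulIf (expf_neq0 t (chi_neq0 (alpha i) c))); rewrite divfK ?expf_neq0 //.
  elim: t => [|t IHt]; first by rewrite subr0 mulr1.
  rewrite -IHt exprS mulrA; congr (_ * _).
  by rewrite -chiDl mulrSr opprD addrA subrK.
have chiN' (b c : 'rV[int]_n) t : chi c (b - alpha i *+ t) = chi c b * chi c (alpha i) ^- t.
  apply: (mulIf (expf_neq0 t (chi_neq0 c (alpha i)))); rewrite divfK ?expf_neq0 //.
  elim: t => [|t IHt]; first by rewrite subr0 mulr1.
  rewrite -IHt exprS mulrA; congr (_ * _).
  by rewrite -chiDr mulrSr opprD addrA subrK.
have C0 m : (m < k)%N -> C m.+1 != 0.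
  move=> mk; have -> : C m.+1 =
      chi (alpha i) a * q ^- k * (1 - q ^+ (k - m)) * \sum_(t < m.+1) q ^+ t.
    have E (t : 'I_m.+1) : cw i (a - alpha i *+ t) =
        chi (alpha i) a * q ^- k * (q ^+ t - q ^+ (k - m) * q ^+ (m - t)).
      have le : (t <= m)%N by rewrite -ltnS.
      rewrite /cw chiN chiN' -/q invfM invrK vK mulrBr; congr (_ - _).
      rewrite -exprD -mulrA; congr (_ * _); apply: (mulfI (expf_neq0 k q0)).
      rewrite mulVKf ?expf_neq0 // -{1}(subnK (leq_trans le (ltnW mk))) exprD mulfK ?expf_neq0 //.
      by congr (_ ^+ _); lia.
    rewrite /C (eq_bigr _ (fun t _ => E t)) -mulr_sumr sumrB -[RHS]mulrA; congr (_ * _).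
    rewrite mulrBl mul1r; congr (_ - _); rewrite -mulr_sumr; congr (_ * _).
    rewrite (reindex_inj rev_ord_inj) /=; apply: eq_bigr => t _.
    by rewrite subSS subKn // -ltnS.
  have q1 : 1 - q != 0 by rewrite subr_eq0 eq_sym; exact: (hq 1%N).
  rewrite !mulf_neq0 ?invr_eq0 ?expf_neq0 //.
    by rewrite subr_eq0 eq_sym hq // subn_gt0.
  suff: (1 - q) * \sum_(t < m.+1) q ^+ t != 0 by apply: contraNneq => ->; rewrite mulr0.
  by rewrite -opprB mulNr -subrX1 oppr_eq0 subr_eq0 hq.
(* From the vanishing [k]-th deletion, each [ad i] removes one deletion until [x] itself is
   reached. *)
have {hF} : forall m, (m <= k)%N -> iter (k - m) (delr i) x = 0.
  elim=> [|m IHm] mk; first by rewrite subn0.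
  have lt : (k - m.+1 < k)%N by rewrite ltn_subrL; case: (k) mk.
  have := EF (k - m.+1)%N; rewrite -subSn // subSS IHm ?(ltnW mk) // linear0.
  move/esym/eqP; rewrite scaler_eq0 oppr_eq0 => /orP[|/eqP//].
  by rewrite -subSS subSn // (negPf (C0 _ lt)).
by move/(_ k (leqnn k)); rewrite subnn.
Qed.

(** * Pairing and bar involution *)

Local Notation U := (inU chi).

Lemma U1 : U (wd [::]). Proof. by rewrite -wordE; exact: inU_one. Qed.

Lemma U_letter i : U (wd [:: i]). Proof. by rewrite -wordE; exact: inU_letter. Qed.

Lemma U_mul x y : U x -> U y -> U (x ** y).
Proof. by rewrite shE; exact: inU_shuffle. Qed.

Lemma U0 : U 0. Proof. by rewrite -(scale0r (wd [::])); exact/inU_scale/U1. Qed.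

Lemma U_lin c x y : U x -> U y -> U (c *: x + y).
Proof. by move=> hx; apply: inU_add; exact: inU_scale. Qed.

Lemma U_sum (T : eqType) (s : seq T) (c : T -> K) (g : T -> F) :
  (forall p, p \in s -> U (g p)) -> U (\sum_(p <- s) c p *: g p).
Proof.
elim: s => [|p s IH] h; first by rewrite big_nil; exact: U0.
rewrite big_cons; apply: U_lin; first by apply: h; rewrite inE eqxx.
by apply: IH => q qs; apply: h; rewrite inE qs orbT.
Qed.

Lemma U_ind (P : F -> Prop) :
  P (wd [::]) -> (forall i, P (wd [:: i])) ->
  (forall c x, U x -> P x -> P (c *: x)) ->
  (forall x y, U x -> U y -> P x -> P y -> P (x + y)) ->
  (forall x y, U x -> U y -> P x -> P y -> P (x ** y)) ->
  forall x, U x -> P x.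
Proof.
move=> P1 Pi PZ PD PM x; elim=> {x} [|i|c x hx Px|x y hx Px hy Py|x y hx Px hy Py].
- by rewrite wordE.
- by rewrite wordE.
- exact: PZ.
- exact: PD.
- by rewrite -shE; exact: PM.
Qed.

Lemma U_diag f : f [::] = 1 -> (forall w i, f (rcons w i) = f w * f [:: i]) ->
  forall x, U x -> U (diag f x).
Proof.
move=> f1 fM; apply: U_ind => [|i|c x _ hx|x y _ _ hx hy|x y _ _ hx hy].
- by rewrite diag_wd f1 scale1r; exact: U1.
- by rewrite diag_wd; apply/inU_scale/U_letter.
- by rewrite linearZ; exact: inU_scale.
- by rewrite linearD; exact: inU_add.
- by rewrite diag_mul //; exact: U_mul.
Qed.

Lemma U_tr k x : U x -> U (tr k x).
Proof.
apply: U_diag => [|w i]; first by rewrite wt_nil chi0l invr1.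
by rewrite wt_rcons wt_letter chiDl invfM.
Qed.

Lemma U_tl k x : U x -> U (tl k x).
Proof.
apply: U_diag => [|w i]; first by rewrite wt_nil chi0r invr1.
by rewrite wt_rcons wt_letter chiDr invfM.
Qed.

(** * Coproduct decompositions with both factors in [U] *)

Lemma DeltaE z u v : (Delta z)@_(u, v) = z@_(v ++ u).
Proof.
elim/word_ind: z => [|c w z IH]; first by rewrite /Delta lin_ext0 !mcoeff0.
rewrite /Delta lin_extP !mcoeffD !mcoeffZ [X in _ + X = _]IH.
have -> // : (lin_ext (fun w0 : W => \sum_(k < (size w0).+1)
    (<< (drop k w0, take k w0) >> : {malg K[(W * W)%type]})) (wd w))@_(u, v) =
    (wd w)@_(v ++ u).
rewrite lin_ext_wd wdE raddf_sum /=.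
under eq_bigr => k _ do rewrite mcoeffU xpair_eqE.
have [->|ne] := eqVneq w (v ++ u).
  rewrite (bigD1 (inord (size v))) //= big1 => [|k kv].
    by rewrite inordK ?size_cat ?ltnS ?leq_addr // drop_size_cat // take_size_cat // !eqxx addr0.
  case: eqP => //= _; case: eqP => //= e; case/eqP: kv; apply: val_inj.
  have kle : (k <= size (v ++ u))%N by rewrite -ltnS.
  have ek : nat_of_ord k = size v by rewrite -(size_takel kle) e.
  by rewrite /= inordK ?ek // size_cat ltnS leq_addr.
rewrite big1 // => k _; case: eqP => //= e1; case: eqP => //= e2.
by case/eqP: ne; rewrite -e1 -e2 cat_take_drop.
Qed.

Lemma tensorE x y u v : (tensor x y)@_(u, v) = x@_u * y@_v.
Proof.
elim/word_ind: x => [|c w x IH]; first by rewrite /tensor lin_ext0 !mcoeff0 mul0r.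
rewrite /tensor lin_extP !mcoeffD !mcoeffZ mulrDl [X in _ + X = _]IH -mulrA.
congr (_ * _ + _); rewrite lin_ext_wd {IH}.
elim/word_ind: y => [|d w' y IH]; first by rewrite lin_ext0 !mcoeff0 mulr0.
rewrite lin_extP !mcoeffD !mcoeffZ mulrDr IH mulrCA; congr (_ * _ + _).
by rewrite lin_ext_wd mcoeffU xpair_eqE !wdE -natrM mulnb.
Qed.

(** A decomposition of [Delta z] read on coefficients, which suits induction on words; [p.1] carries
    the end of the word. *)
Definition splits z (t : seq (F * F)) : Prop :=
  forall u v, z@_(v ++ u) = \sum_(p <- t) p.1@_u * p.2@_v.

Lemma Delta_splits z (t : seq (F * F)) :
  splits z t -> Delta z = \sum_(p <- t) tensor p.1 p.2.
Proof.
move=> h; apply/malgP => -[u v]; rewrite DeltaE h raddf_sum.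
by apply: eq_bigr => p _; rewrite /= tensorE.
Qed.

Lemma sh_suml (T : Type) (s : seq T) (c : T -> K) (g : T -> F) y :
  (\sum_(p <- s) c p *: g p) ** y = \sum_(p <- s) c p *: (g p ** y).
Proof.
elim: s => [|p s IH]; first by rewrite !big_nil sh0l.
by rewrite !big_cons shDl shZl IH.
Qed.

Lemma splits_nil z t : splits z t -> z = \sum_(p <- t) p.1@_[::] *: p.2.
Proof.
move=> h; apply/malgP => v; rewrite -[v in LHS]cats0 h raddf_sum.
by apply: eq_bigr => p _; rewrite /= mcoeffZ.
Qed.

Lemma splits_delr k z t : splits z t ->
  splits (delr k z) [seq (delr k p.1, p.2) | p <- t].
Proof.
move=> h u v; rewrite delrE rcons_cat h big_map.
by apply: eq_bigr => p _; rewrite /= delrE.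
Qed.

(** The letter either joins the initial part [p.2], or joins [p.1] and is then placed after all of
    [p.2], which costs the twist [tr i]. *)
Lemma splits_mulr i z t : splits z t ->
  splits (z ** wd [:: i]) ([seq (p.1, p.2 ** wd [:: i]) | p <- t]
                           ++ [seq (p.1 ** wd [:: i], tr i p.2) | p <- t]).
Proof.
move=> h u v; rewrite big_cat !big_map /=.
elim/last_ind: u z t h => [|u k IH] z t h.
  rewrite cats0 [X in _ = _ + X]big1 ?addr0 => [|p _].
    rewrite [z](splits_nil h) sh_suml raddf_sum.
    by apply: eq_bigr => p _; rewrite /= mcoeffZ.
  by rewrite sh_coef0 [(wd _)@__]wdE mulr0 mul0r.
rewrite -rcons_cat -delrE delr_mul delr_letter shZr sh1r mcoeffD mcoeffZ.
rewrite (IH _ _ (splits_delr k h)) !big_map /= -addrA.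
congr (_ + _); first by apply: eq_bigr => p _; rewrite delrE.
under [RHS]eq_bigr => p _ do
  rewrite -delrE delr_mul delr_letter shZr sh1r mcoeffD mcoeffZ mulrDl.
rewrite big_split /=; congr (_ + _).
have [->|_] := eqVneq i k; last first.
  by rewrite mul0r big1 // => p _; rewrite !mul0r.
rewrite mul1r trE h mulr_sumr; apply: eq_bigr => p _.
by rewrite mul1r !trE wt_cat chiDl invfM; ring.
Qed.

Lemma splits_mull i z t : splits z t ->
  splits (wd [:: i] ** z) ([seq (tl i p.1, wd [:: i] ** p.2) | p <- t]
                           ++ [seq (wd [:: i] ** p.1, p.2) | p <- t]).
Proof.
move=> h u v; rewrite big_cat !big_map /=.
elim/last_ind: u z t h => [|u k IH] z t h.
  rewrite cats0 [X in _ = _ + X]big1 ?addr0 => [|p _].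
    rewrite [z](splits_nil h) linear_sum raddf_sum; apply: eq_bigr => p _.
    by rewrite /= shZr mcoeffZ tlE wt_nil chi0r invr1 mul1r.
  by rewrite sh_coef0 [(wd _)@__]wdE mul0r mul0r.
rewrite -rcons_cat -delrE delr_mul delr_letter shZl sh1l tr_wd shZl.
rewrite mcoeffD !mcoeffZ (IH _ _ (splits_delr k h)) !big_map /=.
under [in RHS]eq_bigr => p _ do rewrite -delrE delr_tl mcoeffZ -mulrA.
under [X in _ = _ + X]eq_bigr => p _ do
  rewrite -delrE delr_mul delr_letter shZl sh1l tr_wd shZl mcoeffD !mcoeffZ mulrDl -!mulrA.
rewrite big_split /= -!mulr_sumr wt_letter addrCA mulrDr; congr (_ + (_ + _)).
by rewrite h.
Qed.

(** The product rules of the pairing apply once [Delta z] splits over [U]; closure under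
    combinations and one-letter products covers the vectors [adw a t]. *)
Definition decomposable z := exists2 t, in_UU chi t & splits z t.

Lemma splits1 : splits (wd [::]) [:: (wd [::], wd [::])].
Proof.
move=> u v; rewrite big_seq1 /= !wdE -natrM mulnb.
by case: u v => [|? ?] [|? ?].
Qed.

Lemma splits_letter i :
  splits (wd [:: i]) [:: (wd [::], wd [:: i]); (wd [:: i], wd [::])].
Proof. by have := splits_mulr i splits1; rewrite /= sh1l tr1. Qed.

Lemma in_UU1 : in_UU chi [:: (wd [::], wd [::])].
Proof. by move=> p; rewrite inE => /eqP ->; split; exact: U1. Qed.

Lemma in_UU_letter i :
  in_UU chi [:: (wd [::], wd [:: i]); (wd [:: i], wd [::])].
Proof.
move=> p; rewrite !inE => /orP[] /eqP ->; split => /=;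
  solve [exact: U1 | exact: U_letter].
Qed.

Lemma decomposable1 : decomposable (wd [::]).
Proof. by exists [:: (wd [::], wd [::])]; [exact: in_UU1 | exact: splits1]. Qed.

Lemma decomposable_lin c x y :
  decomposable x -> decomposable y -> decomposable (c *: x + y).
Proof.
move=> [t ht sx] [t' ht' sy]; exists ([seq (c *: p.1, p.2) | p <- t] ++ t').
  move=> p; rewrite mem_cat => /orP[/mapP[q /ht [q1 q2] ->]|/ht' //].
  by split=> //=; exact: inU_scale.
move=> u v; rewrite mcoeffD mcoeffZ big_cat big_map sx sy mulr_sumr /=.
by congr (_ + _); apply: eq_bigr => p _; rewrite mcoeffZ mulrA.
Qed.

Lemma decomposable_mulr i z : decomposable z -> decomposable (z ** wd [:: i]).
Proof.
move=> [t ht sz]; exists ([seq (p.1, p.2 ** wd [:: i]) | p <- t]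
  ++ [seq (p.1 ** wd [:: i], tr i p.2) | p <- t]); last exact: splits_mulr.
move=> p; rewrite mem_cat => /orP[] /mapP[q /ht [q1 q2] ->]; split => //=.
- exact: U_mul q2 (U_letter i).
- exact: U_mul q1 (U_letter i).
- exact: U_tr.
Qed.

Lemma decomposable_mull i z : decomposable z -> decomposable (wd [:: i] ** z).
Proof.
move=> [t ht sz]; exists ([seq (tl i p.1, wd [:: i] ** p.2) | p <- t]
  ++ [seq (wd [:: i] ** p.1, p.2) | p <- t]); last exact: splits_mull.
move=> p; rewrite mem_cat => /orP[] /mapP[q /ht [q1 q2] ->]; split => //=.
- exact: U_tl.
- exact: U_mul (U_letter i) q2.
- exact: U_mul (U_letter i) q1.
Qed.

(** * Adjointness of letter multiplications and deletions *)

Section Pairing.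
Variable B : F -> F -> K.
Hypothesis hB : is_pairing chi B.

Lemma pair0l y : U y -> B 0 y = 0.
Proof.
move=> hy; have := pairing_linear_l hB (-1) U0 U0 hy.
by rewrite scaler0 addr0 mulN1r addNr.
Qed.

Lemma pairDl x y z : U x -> U y -> U z -> B (x + y) z = B x z + B y z.
Proof.
by move=> hx hy hz; rewrite -[x in LHS]scale1r (pairing_linear_l hB) // mul1r.
Qed.

Lemma pairZl c x z : U x -> U z -> B (c *: x) z = c * B x z.
Proof.
move=> hx hz; rewrite -[c *: x]addr0 (pairing_linear_l hB) ?pair0l ?addr0 //.
exact: U0.
Qed.

Lemma pair_sum (T : eqType) (s : seq T) (c : T -> K) (g : T -> F) y :
  U y -> (forall p, p \in s -> U (g p)) ->
  B (\sum_(p <- s) c p *: g p) y = \sum_(p <- s) c p * B (g p) y.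
Proof.
move=> hy; elim: s => [|p s IH] h; first by rewrite !big_nil pair0l.
have hs q : q \in s -> U (g q) by move=> qs; apply: h; rewrite inE qs orbT.
have hp : U (g p) by apply: h; rewrite inE eqxx.
by rewrite !big_cons (pairing_linear_l hB) ?IH //; exact: U_sum.
Qed.

(** Since [Delta] of the empty word is group-like, pairing with it is multiplicative, and the
    grading makes it vanish on letters. *)
Lemma pair_one x : U x -> B x (wd [::]) = x@_[::].
Proof.
move: x; apply: U_ind => [|i|c x hx IH|x y hx hy IHx IHy|x y hx hy IHx IHy].
- by rewrite wdE -wordE (pairing_one hB).
- rewrite wdE; apply: (pairing_graded hB (a := alpha i) (b := 0)).
  + exact: U_letter.
  + exact: U1.
  + by rewrite -wt_letter; exact/hom_homogeneous/hom_wd.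
  + by rewrite -wt_nil; exact/hom_homogeneous/hom_wd.
  + by apply/eqP => /rowP /(_ i); rewrite alphaE mxE eqxx.
- by rewrite pairZl ?mcoeffZ ?IH //; exact: U1.
- by rewrite pairDl ?mcoeffD ?IHx ?IHy //; exact: U1.
rewrite shE (pairing_shuffle_l hB hx hy U1 in_UU1 (Delta_splits splits1)) -shE.
by rewrite big_seq1 /= IHx IHy sh_coef0 mulrC.
Qed.

Lemma pair_letter i x : U x -> B x (wd [:: i]) = x@_[:: i].
Proof.
move: x; apply: U_ind => [|j|c x hx IH|x y hx hy IHx IHy|x y hx hy IHx IHy].
- rewrite wdE; apply: (pairing_graded hB (a := 0) (b := alpha i)).
  + exact: U1.
  + exact: U_letter.
  + by rewrite -wt_nil; exact/hom_homogeneous/hom_wd.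
  + by rewrite -wt_letter; exact/hom_homogeneous/hom_wd.
  + by apply/eqP => /rowP /(_ i); rewrite alphaE mxE eqxx.
- by rewrite wdE -!wordE (pairing_letters hB) eqseq_cons andbT.
- by rewrite pairZl ?mcoeffZ ?IH //; exact: U_letter.
- by rewrite pairDl ?mcoeffD ?IHx ?IHy //; exact: U_letter.
have sl := Delta_splits (splits_letter i).
rewrite shE (pairing_shuffle_l hB hx hy (U_letter i) (in_UU_letter (i := i)) sl) -shE.
rewrite big_cons big_seq1 /= !pair_one // IHx IHy.
have -> : (x ** y)@_[:: i] = x@_[:: i] * y@_[::] + x@_[::] * y@_[:: i].
  rewrite -[[:: i]]/(rcons [::] i) -!delrE delr_mul mcoeffD !sh_coef0 trE.
  by rewrite wt_nil chi0l invr1 mul1r.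
by rewrite mulrC [_ * x@_[::]]mulrC.
Qed.

(** The product rule pairs the letter with [p.1], the end of the word, and so retains [\sum
    p.1@_[:: i] *: p.2], the right deletion. *)
Lemma pair_mulr i z y : decomposable z -> U z -> U y ->
  B z (y ** wd [:: i]) = B (delr i z) y.
Proof.
move=> [t ht st] hz hy; have hi := U_letter i.
rewrite shE (pairing_shuffle_r hB hz hy hi ht (Delta_splits st)).
have -> : delr i z = \sum_(p <- t) p.1@_[:: i] *: p.2.
  apply/malgP => w; rewrite delrE -cats1 st raddf_sum.
  by apply: eq_bigr => p _; rewrite /= mcoeffZ.
rewrite pair_sum // => [|p /ht []//]; apply: eq_big_seq => p /ht [hp _].
by rewrite pair_letter.
Qed.

Lemma pair_mull i z y : decomposable z -> U z -> U y ->
  B z (wd [:: i] ** y) = B (dell i z) y.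
Proof.
move=> [t ht st] hz hy; have hi := U_letter i.
rewrite shE (pairing_shuffle_r hB hz hi hy ht (Delta_splits st)).
have -> : dell i z = \sum_(p <- t) p.2@_[:: i] *: p.1.
  apply/malgP => w; rewrite dellE -cat1s st raddf_sum.
  by apply: eq_bigr => p _; rewrite /= mcoeffZ mulrC.
rewrite pair_sum // => [|p /ht []//]; apply: eq_big_seq => p /ht [_ hp].
by rewrite pair_letter // mulrC.
Qed.

End Pairing.

(** * The bar involution over an abstract scalar map *)

Section Bar.
Variable sigma : K -> K.
Hypothesis sigmaD : {morph sigma : c d / c + d}.
Hypothesis sigmaM : {morph sigma : c d / c * d}.
Hypothesis sigma1 : sigma 1 = 1.
Hypothesis sigma_chi : forall a b, sigma (chi a b) = (chi b a)^-1.

Lemma sigma0 : sigma 0 = 0.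
Proof. by apply: (addrI (sigma 0)); rewrite -sigmaD !addr0. Qed.

Lemma sigmaV c : c != 0 -> sigma c^-1 = (sigma c)^-1.
Proof.
move=> c0; have e : sigma c * sigma c^-1 = 1 by rewrite -sigmaM mulfV.
have s0 : sigma c != 0 by apply: contra_eq_neq e => ->; rewrite mul0r eq_sym oner_neq0.
by apply: (mulfI s0); rewrite e mulfV.
Qed.

Lemma bar_coef_nil : bar_coef chi [::] = 1.
Proof. by rewrite /bar_coef big_ord0. Qed.

(** The pairs of positions are split by whether the smaller one is the initial [k]. *)
Lemma bar_coef_cons k w :
  bar_coef chi (k :: w) = bar_coef chi w * (chi (wt w) (alpha k))^-1.
Proof.
rewrite /bar_coef big_ord_recl big1 ?mul1r => [|j]; last by rewrite ltn0.
have -> : (chi (wt w) (alpha k))^-1 =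
    \prod_(l < size w) (chi (alpha (tnth (in_tuple w) l)) (alpha k))^-1.
  have -> : chi (wt w) (alpha k) = \prod_(i <- w) chi (alpha i) (alpha k).
    elim: w => [|i w IH]; first by rewrite wt_nil chi0l big_nil.
    by rewrite wt_cons chiDl IH big_cons.
  by rewrite (big_tnth _ _ w) -prodfV.
rewrite -big_split /=; apply: eq_bigr => l _.
rewrite big_mkcond big_ord_recl /= mulrC [in RHS]big_mkcond; congr (_ * _).
  by apply: eq_bigr => m _; rewrite !(tnth_nth k).
by rewrite !(tnth_nth k).
Qed.

Local Notation bar := (bar chi sigma).

Lemma barE x w : (bar x)@_w = sigma x@_(rev w) * bar_coef chi (rev w).
Proof.
rewrite /bar raddf_sum /=.
under eq_bigr => v _ do rewrite mcoeffZ wordE wdE.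
have [xw|xw] := boolP (rev w \in msupp x); last first.
  rewrite mcoeff_outdom // sigma0 mul0r big_seq big1 // => v xv.
  by case: eqP => [e|_]; rewrite ?mulr0 //; rewrite -e revK xv in xw.
rewrite (big_fsetD1 _ xw) /= revK eqxx mulr1 big1_fset ?addr0 // => v.
rewrite !inE => /andP[ne _] _; case: eqP => [e|_]; rewrite ?mulr0 //.
by rewrite -e revK eqxx in ne.
Qed.

Lemma bar_lin c x y : bar (c *: x + y) = sigma c *: bar x + bar y.
Proof.
apply/malgP => w; rewrite barE !mcoeffD !mcoeffZ !barE sigmaD sigmaM.
by rewrite mulrDl mulrA.
Qed.

Lemma bar_wd_nil : bar (wd [::]) = wd [::].
Proof.
apply/malgP => w; rewrite barE !wdE -[[::] == w](inj_eq (can_inj (@revK _))).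
by case: (rev w) => [|? ?]; rewrite ?bar_coef_nil ?sigma1 ?mulr1 ?sigma0 ?mul0r.
Qed.

Lemma bar_letter i : bar (wd [:: i]) = wd [:: i].
Proof.
apply/malgP => w; rewrite barE !wdE -[[:: i] == w](inj_eq (can_inj (@revK _))).
case: eqP => [<-|]; last by rewrite sigma0 mul0r.
by rewrite bar_coef_cons bar_coef_nil wt_nil chi0l invr1 sigma1 !mulr1.
Qed.

(** Reversal exchanges final and initial letters; [tr k] is the factor that the letter contributes
    to [bar_coef]. *)
Lemma delr_bar k x : delr k (bar x) = tr k (bar (dell k x)).
Proof.
apply/malgP => w; rewrite delrE trE !barE dellE rev_rcons bar_coef_cons wt_rev.
by rewrite mulrA mulrC.
Qed.

Lemma tr_bar_tl k x : tr k (bar (tl k x)) = bar x.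
Proof.
apply/malgP => w; rewrite trE !barE tlE sigmaM sigmaV // sigma_chi invrK wt_rev.
by rewrite !mulrA mulVf ?mul1r.
Qed.

(** Through [delr_bar] the right Leibniz rule for the image becomes the left one for [x ** y]; the
    twists [tl k] and [tr k] cancel across [bar]. *)
Lemma bar_mul x y : bar (x ** y) = bar x ** bar y.
Proof.
apply/malgP => w; elim/last_ind: w x y => [|w k IH] x y.
  by rewrite barE !sh_coef0 !barE bar_coef_nil !mulr1 sigmaM.
rewrite -!delrE delr_bar delr_mul !delr_bar trE dell_mul.
rewrite -[_ ** tl k y]scale1r bar_lin sigma1 scale1r mcoeffD !IH -mcoeffD.
by rewrite -trE linearD /= !tr_mul tr_bar_tl.
Qed.

Lemma U_bar x : U x -> U (bar x).
Proof.
move: x; apply: U_ind => [|i|c x _ hx|x y _ _ hx hy|x y _ _ hx hy].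
- by rewrite bar_wd_nil; exact: U1.
- by rewrite bar_letter; exact: U_letter.
- have b0 : bar 0 = 0 by apply/malgP => w; rewrite barE !mcoeff0 sigma0 mul0r.
  by rewrite -[c *: x]addr0 bar_lin b0 addr0; exact: inU_scale.
- by rewrite -[x]scale1r bar_lin sigma1 scale1r; exact: inU_add.
- by rewrite bar_mul; exact: U_mul.
Qed.

Lemma bar_ad a i x : hom a x ->
  bar (ad i x) = bar x ** wd [:: i] - (chi a (alpha i))^-1 *: (wd [:: i] ** bar x).
Proof.
move=> hx; rewrite adE (hom_sl _ hx) shZr addrC -scaleNr bar_lin !bar_mul.
rewrite bar_letter addrC; congr (_ + _).
have -> : sigma (- chi (alpha i) a) = - (chi a (alpha i))^-1.
  apply: (addrI (sigma (chi (alpha i) a))).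
  by rewrite -sigmaD subrr sigma0 sigma_chi subrr.
by rewrite scaleNr.
Qed.

End Bar.

(** * The vectors R_l and their weights *)

Section Lyndon.
Variable leI : rel 'I_n.

(** The comparison with the right factor starting at the first [b] is decided by the first
    letters. *)
Lemma lyndon_min a t : lyndon leI (a :: t) -> a \notin t ->
  forall b, b \in t -> (a != b) && leI a b.
Proof.
move=> /andP[_ /forallP h] at_ b bt.
have lt : ((index b t).+1 < size (a :: t))%N by rewrite /= ltnS index_mem.
have := h (Ordinal lt); rewrite /= (drop_nth b) ?index_mem // nth_index //=.
case/orP => // /andP[/eqP ab]; by rewrite ab bt in at_.
Qed.

Lemma lyndon_cons a t : (forall b, b \in t -> (a != b) && leI a b) ->
  lyndon leI (a :: t).
Proof.
move=> h; apply/andP; split=> //; apply/forallP => -[[|k] /= hk] //.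
by rewrite (drop_nth a) //= h ?mem_nth.
Qed.

(** Every nonempty prefix is Lyndon, its first letter being strictly smaller than the others, so the
    longest proper one omits only [i]. *)
Lemma costandard_rcons a t i :
  (forall b, b \in rcons t i -> (a != b) && leI a b) ->
  costandard leI (a :: rcons t i) = (a :: t, [:: i]).
Proof.
move=> h; rewrite /costandard; set m := (\max_(_ < _ | _) _)%N.
have -> : m = (size t).+1.
  apply/eqP; rewrite eqn_leq; apply/andP; split.
    by apply/bigmax_leqP => -[k /= kl] _; rewrite size_rcons ltnS in kl.
  have lt : ((size t).+1 < size (a :: rcons t i))%N by rewrite /= size_rcons.
  apply: (leq_trans _ (leq_bigmax_cond (Ordinal lt) _)) => //.
  rewrite /= -cats1 take_size_cat //; apply: lyndon_cons => b bt.
  by apply: h; rewrite mem_rcons inE bt orbT.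
by rewrite /= -cats1 take_size_cat // drop_size_cat.
Qed.

Definition adw a (t : W) : F := foldl (fun x i => ad i x) (wd [:: a]) t.

Lemma adw_rcons a t i : adw a (rcons t i) = ad i (adw a t).
Proof. exact: foldl_rcons. Qed.

Lemma hom_adw a t : hom (wt (a :: t)) (adw a t).
Proof.
elim/last_ind: t => [|t i IH]; first exact: hom_wd.
by rewrite adw_rcons -rcons_cons wt_rcons; exact: hom_ad.
Qed.

Lemma ad_hom a i x : hom a x ->
  ad i x = (- chi (alpha i) a) *: (wd [:: i] ** x) + x ** wd [:: i].
Proof. by move=> hx; rewrite adE (hom_sl _ hx) shZr scaleNr addrC. Qed.

Lemma U_adw a t : U (adw a t).
Proof.
elim/last_ind: t => [|t i IH]; first exact: U_letter.
rewrite adw_rcons (ad_hom _ (hom_adw a t)).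
by apply: U_lin; apply: U_mul => //; exact: U_letter.
Qed.

Lemma decomposable_adw a t : decomposable (adw a t).
Proof.
elim/last_ind: t => [|t i IH].
  by have := decomposable_mulr a decomposable1; rewrite sh1l.
rewrite adw_rcons (ad_hom _ (hom_adw a t)); apply: decomposable_lin.
  exact: decomposable_mull.
exact: decomposable_mulr.
Qed.

(** Each costandard factorization splits off one letter, and the two-term recursion is [ad i] on a
    vector of known weight. *)
Lemma Rw_adw a t : (forall b, b \in t -> (a != b) && leI a b) ->
  Rw chi leI (a :: t) = adw a t.
Proof.
elim/last_ind: t => [|t i IH] h; first by rewrite Rw_letter wordE.
have := @Rw_costandard n K chi leI (a :: rcons t i).
rewrite costandard_rcons //= size_rcons => /(_ isT) ->.
rewrite IH => [|b bt]; last by apply: h; rewrite mem_rcons inE bt orbT.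
rewrite Rw_letter wordE -!shE wt_letter adw_rcons (ad_hom _ (hom_adw a t)).
by rewrite scaleNr addrC.
Qed.

End Lyndon.

Lemma dell_letter k j : dell k (wd [:: j]) = (j == k)%:R *: wd [::].
Proof.
apply/malgP => w; rewrite dellE mcoeffZ !wdE eqseq_cons.
by rewrite -natrM mulnb.
Qed.

Lemma dell_sl k j x : dell k (sl j x) = chi (alpha j) (alpha k) *: sl j (dell k x).
Proof.
by apply/malgP => w; rewrite dellE mcoeffZ !slE dellE wt_cons chiDr mulrA.
Qed.

Lemma tl_sl k x : tl k (sl k x) = x.
Proof. by apply/malgP => w; rewrite tlE slE mulrA mulVf ?mul1r. Qed.

(** For [j = i] both products return [x]: in the second, [tl i] undoes [sl i]. *)
Lemma dell_ad j i x : dell j x = 0 -> dell j (ad i x) = 0.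
Proof.
move=> x0; rewrite adE linearB /= !dell_mul dell_sl x0 sh0l add0r linear0 scaler0.
rewrite sh0r addr0 dell_letter shZl shZr sh1l sh1r.
by have [->|_] := eqVneq i j; rewrite ?scale0r ?subrr // tl_sl subrr.
Qed.

Lemma dell_adw j a t : j != a -> dell j (adw a t) = 0.
Proof.
move=> ja; elim/last_ind: t => [|t i IH]; last by rewrite adw_rcons dell_ad.
by rewrite dell_letter eq_sym (negPf ja) scale0r.
Qed.

(** * Integrability and the weights that occur *)

Hypothesis serre : forall i j, i != j -> adnil i (wd [:: j]).

(** Letters other than [i] are nilpotent by [serre], and nilpotency passes to products and
    combinations; a letter [i] enters only through [ad i] itself. *)
Lemma adnil_adw i a t : i != a -> adnil i (adw a t).
Proof.
move=> ia; elim/last_ind: t => [|t j IH]; first exact: serre.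
rewrite adw_rcons; have [<-|ij] := eqVneq i j; first exact: adnil_ad.
rewrite (ad_hom _ (hom_adw a t)).
by apply: adnil_lin; apply: adnil_mul => //; exact: serre.
Qed.

(* Vectors of weight [g] in an integrable module over the Levi part on the letters
   other than [a], with lowest weight vector [a] and operators [ad i], [delr i]. *)
Definition adjoint a (g : 'rV[int]_n) y :=
  [/\ hom g y, g 0 a = 1, forall j, j != a -> dell j y = 0
    & forall i, i != a -> adnil i y].

Lemma adjoint_delr a j g y :
  j != a -> adjoint a g y -> adjoint a (g - alpha j) (delr j y).
Proof.
move=> ja [hy ga hl hn]; split.
- exact: hom_delr.
- by rewrite mxE [(- alpha j) _ _]mxE alphaE (negPf ja) oppr0 addr0.
- by move=> i ia; rewrite dell_delr hl // linear0.
- by move=> i ia; exact: adnil_delr hy (hn i ia).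
Qed.

Lemma adjoint_delr_iter a j g y (k : nat) : j != a -> adjoint a g y ->
  adjoint a (g - alpha j *+ k) (iter k (delr j) y).
Proof.
move=> ja hy; elim: k => [|k IH]; first by rewrite subr0.
by rewrite mulrSr opprD addrA; exact: adjoint_delr.
Qed.

Lemma wt_count w a : wt w 0 a = (count_mem a w)%:Z.
Proof.
elim: w => [|i w IH]; first by rewrite wt_nil mxE.
by rewrite wt_cons mxE alphaE IH /= PoszD; congr (_ + _); case: (i == a).
Qed.

(** A word in the support starts with [a], as other initial deletions vanish, and contains it once;
    beyond length one its last letter is some [j != a], and [delr j] detects the word. *)
Lemma adjoint_neq0 a g y : adjoint a g y -> y != 0 ->
  g = alpha a \/ exists2 j, j != a & delr j y != 0.
Proof.
move=> [hy ga hl _] /malg_neq0[w]; rewrite -mcoeff_neq0 => yw.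
have wg := (homP _ _).1 hy _ yw.
have cw1 : count_mem a w = 1%N by apply/eqP; rewrite -eqz_nat -wt_count wg ga.
case: w yw wg cw1 => [//|b w] yw wg cw1.
have ba : b = a.
  by apply/eqP/negP => /negP /hl /malgP /(_ w); rewrite dellE mcoeff0; apply/eqP.
case/lastP: w yw wg cw1 => [|w j] yw wg cw1.
  by left; rewrite -wg wt_letter ba.
right; exists j.
  by apply: contra_eq_neq cw1 => ->; rewrite ba -cats1 /= count_cat /= !eqxx; lia.
apply: contra_neq yw => /malgP /(_ (b :: w)).
by rewrite delrE mcoeff0.
Qed.

(* A non-root weight [g] of least height has a root below it, [g - alpha j], hence
   a positive pairing with [alpha j]; integrability makes its reflection a smaller
   non-root weight. *)
Lemma adjoint_eq0 (Phi : pred 'rV[int]_n) :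
  (forall i, alpha i \in Phi) ->
  (forall i m, (0 < m)%N -> chi (alpha i) (alpha i) ^+ m != 1) ->
  (forall (g : 'rV_n) a j, j != a -> g 0 a = 1 ->
     g - alpha j \in Phi -> g \notin Phi ->
     exists k : nat, [/\ (0 < k)%N, g - alpha j *+ k \notin Phi &
       chi g (alpha j) * chi (alpha j) g = chi (alpha j) (alpha j) ^+ k]) ->
  forall a g y, adjoint a g y -> g \notin Phi -> y = 0.
Proof.
move=> Phi_simple chi_q Phi_refl a.
pose ht (g : 'rV[int]_n) : int := \sum_i g 0 i.
have htB g j (k : nat) : ht (g - alpha j *+ k) = ht g - k%:Z.
  rewrite /ht; under eq_bigr => i _ do rewrite mxE mxE mulmxnE alphaE.
  rewrite big_split /= sumrN; congr (_ - _).
  rewrite (bigD1 j) //= eqxx big1 ?addr0 => [|i ij]; first by rewrite -[RHS]natz.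
  by rewrite eq_sym (negPf ij) mul0rn.
have ht_wt w : ht (wt w) = (size w)%:Z.
  elim: w => [|i w IH]; first by rewrite /ht wt_nil big1 // => i _; rewrite mxE.
  rewrite /ht wt_cons; under eq_bigr => l _ do rewrite mxE alphaE.
  rewrite big_split /= [X in _ + X]IH (bigD1 i) //= eqxx big1 ?addr0 => [|l li].
    by rewrite -PoszD.
  by rewrite eq_sym (negPf li).
suff claim (m : nat) g y : ht g <= m%:Z -> adjoint a g y -> g \notin Phi -> y = 0.
  move=> g y; apply: (claim `|ht g|%N); exact: ler_norm.
(* Height at most 0 is impossible, as [g] is the weight of a word containing [a]. *)
elim: m g y => [|m IH] g y hg hy gPhi; apply/eqP/negP => /negP y0.
  have [hom_y ga _ _] := hy; have [w] := malg_neq0 y0.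
  rewrite -mcoeff_neq0 => /((homP _ _).1 hom_y) wg.
  have s0 : size w = 0%N.
    by apply/eqP; rewrite -leqn0 -lez_nat -ht_wt wg.
  by move: wg ga; rewrite (size0nil s0) wt_nil => <-; rewrite mxE.
have [ga|[j ja dj]] := adjoint_neq0 hy y0; first by rewrite ga Phi_simple in gPhi.
(* Otherwise the induction hypothesis would kill [delr j y], whose weight has smaller height. *)
have gj : g - alpha j \in Phi.
  apply/negP => /negP /(IH _ (delr j y)) d0.
  rewrite d0 ?eqxx // in dj; last exact: adjoint_delr.
  by rewrite -[alpha j]mulr1n htB lerBlDr -PoszD addn1.
have [hom_y ga _ hn] := hy.
have [k [k0 kPhi hk]] := Phi_refl _ _ _ ja ga gj gPhi.
case/eqP: y0; apply: (delrn_inj hom_y (chi_q j) hk (hn j ja)).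
apply: IH (adjoint_delr_iter _ ja hy) kPhi.
rewrite htB lerBlDr; apply: le_trans hg _; rewrite -PoszD lez_nat; lia.
Qed.

(** After [bar_ad], the product with [i] on the left contributes nothing since [dell i] kills the
    first argument; the one with [i] on the right brings in [delr i (ad i x)], which is [cw] times
    [x]. *)
Lemma pairing_ad (B : F -> F -> K) (sigma : K -> K) (a i : 'I_n) (t : W) :
  is_pairing chi B ->
  {morph sigma : c d / c + d} -> {morph sigma : c d / c * d} -> sigma 1 = 1 ->
  (forall b c, sigma (chi b c) = (chi c b)^-1) ->
  i != a -> delr i (adw a t) = 0 ->
  B (ad i (adw a t)) (bar chi sigma (ad i (adw a t)))
  = cw i (wt (a :: t)) * B (adw a t) (bar chi sigma (adw a t)).
Proof.
move=> hB sD sM s1 sX ia d0; set x := adw a t.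
have hx : hom (wt (a :: t)) x := hom_adw a t.
have Ux : U x := U_adw a t.
have Ubx : U (bar chi sigma x) := U_bar sD sM s1 sX Ux.
have Uz : U (ad i x) by rewrite /x -adw_rcons; exact: U_adw.
have dz : decomposable (ad i x) by rewrite /x -adw_rcons; exact: decomposable_adw.
rewrite (bar_ad sD sM s1 sX _ hx) addrC -scaleNr.
have Ul := U_mul (U_letter i) Ubx; have Ur := U_mul Ubx (U_letter i).
rewrite (pairing_linear_r hB) // (pair_mull hB) // (pair_mulr hB) //.
rewrite dell_ad ?dell_adw // (pair0l hB) // mulr0 add0r.
by rewrite (delr_ad_hom _ hx) d0 linear0 add0r (pairZl hB).
Qed.

End Shuffle.

(** * Root systems *)

Section RootSystem.
Variables (n : nat) (G : 'M[int]_n) (Phi : {fset 'rV[int]_n}).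
Hypothesis hPhi : is_root_system G Phi.
Local Notation Q := 'rV[int]_n.
Implicit Types (a b : Q) (M : 'I_n -> 'I_n -> int).

(** A common shape to which both [dot] and [euler] unfold. *)
Definition form M a b : int := \sum_i \sum_j a 0 i * M i j * b 0 j.

Lemma formDl M a b c : form M (a + b) c = form M a c + form M b c.
Proof.
rewrite /form -big_split; apply: eq_bigr => i _.
rewrite -big_split; apply: eq_bigr => j _; rewrite /= !mxE; ring.
Qed.

Lemma formDr M a b c : form M a (b + c) = form M a b + form M a c.
Proof.
rewrite /form -big_split; apply: eq_bigr => i _.
rewrite -big_split; apply: eq_bigr => j _; rewrite /= !mxE; ring.
Qed.

Lemma formZl M k a c : form M (k *: a) c = k * form M a c.
Proof.
rewrite /form mulr_sumr; apply: eq_bigr => i _.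
rewrite mulr_sumr; apply: eq_bigr => j _; rewrite /= !mxE; ring.
Qed.

Lemma formZr M k a b : form M a (k *: b) = k * form M a b.
Proof.
rewrite /form mulr_sumr; apply: eq_bigr => i _.
rewrite mulr_sumr; apply: eq_bigr => j _; rewrite /= !mxE; ring.
Qed.

Lemma formNl M a c : form M (- a) c = - form M a c.
Proof. by rewrite -scaleN1r formZl mulN1r. Qed.

Lemma formNr M a b : form M a (- b) = - form M a b.
Proof. by rewrite -scaleN1r formZr mulN1r. Qed.

Lemma form_alpha M i j : form M (alpha i) (alpha j) = M i j.
Proof.
rewrite /form (bigD1 i) //= [X in _ + X]big1 => [|k ki]; last first.
  by apply: big1 => l _; rewrite alphaE eq_sym (negPf ki) !mul0r.
rewrite addr0 (bigD1 j) //= big1 => [|k kj]; last first.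
  by rewrite !alphaE [j == k]eq_sym (negPf kj) mulr0.
by rewrite !alphaE !eqxx mul1r mulr1 addr0.
Qed.

Lemma eq_form M M' a b : (forall i j, M i j = M' i j) -> form M a b = form M' a b.
Proof. by move=> e; apply: eq_bigr => i _; apply: eq_bigr => j _; rewrite e. Qed.

Lemma formC M a b : form M a b = form (fun i j => M j i) b a.
Proof.
rewrite /form exchange_big; apply: eq_bigr => i _; apply: eq_bigr => j _ /=.
ring.
Qed.

Lemma form_add M M' a b : form M a b + form M' a b = form (fun i j => M i j + M' i j) a b.
Proof.
rewrite /form -big_split; apply: eq_bigr => i _; rewrite -big_split.
by apply: eq_bigr => j _; rewrite /= mulrDr mulrDl.
Qed.

Local Notation dot := (dot G).

Lemma dotE a b : dot a b = form (fun i j => G i j) a b. Proof. by []. Qed.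

Definition dotDl a b c : dot (a + b) c = dot a c + dot b c := formDl _ a b c.
Definition dotDr a b c : dot a (b + c) = dot a b + dot a c := formDr _ a b c.
Definition dotNl a b : dot (- a) b = - dot a b := formNl _ a b.
Definition dotNr a b : dot a (- b) = - dot a b := formNr _ a b.
Definition dotZl k a b : dot (k *: a) b = k * dot a b := formZl _ k a b.
Definition dotZr k a b : dot a (k *: b) = k * dot a b := formZr _ k a b.
Definition dot_alpha i j : dot (alpha i) (alpha j) = G i j := form_alpha _ i j.

Lemma dotC a b : dot a b = dot b a.
Proof.
rewrite !dotE formC; apply: eq_form => i j.
by rewrite -[in LHS](gram_sym hPhi) mxE.
Qed.

Lemma dot_gt0 a : a \in Phi -> 0 < dot a a.
Proof.
move=> aPhi; apply: (gram_posdef hPhi); apply: contraTneq aPhi => ->.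
exact: root_neq0 hPhi.
Qed.

(** The vector is [dot a a] times the component of [b] orthogonal to [a]; the scaling avoids
    division in the lattice. *)
Lemma dot_comb a b :
  dot (dot a a *: b - dot a b *: a) (dot a a *: b - dot a b *: a)
  = dot a a * (dot a a * dot b b - dot a b ^+ 2).
Proof.
rewrite dotDl !dotDr !dotNl !dotNr !dotZl !dotZr [dot b a]dotC; ring.
Qed.

Lemma dot_CS a b : a \in Phi -> dot a b ^+ 2 <= dot a a * dot b b.
Proof.
move=> /dot_gt0 a0; rewrite -subr_ge0 -(pmulr_rge0 _ a0) -dot_comb.
have [->|x0] := eqVneq (dot a a *: b - dot a b *: a) 0; last exact/ltW/(gram_posdef hPhi).
by rewrite -[X in dot X X](scale0r (0 : Q)) dotZl mul0r.
Qed.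

Lemma dot_CS_lt a b : a \in Phi -> dot a a *: b != dot a b *: a ->
  dot a b ^+ 2 < dot a a * dot b b.
Proof.
move=> /dot_gt0 a0 ne; rewrite -subr_gt0 -(pmulr_rgt0 _ a0) -dot_comb.
by apply: (gram_posdef hPhi); rewrite subr_eq0.
Qed.

Lemma cartan_int a b : a \in Phi -> b \in Phi -> exists k, 2 * dot a b = k * dot a a.
Proof. by move=> aP bP; apply/dvdzP; exact: (root_crystallographic hPhi). Qed.

Lemma root_refl a b k : a \in Phi -> b \in Phi -> 2 * dot a b = k * dot a a ->
  b - k *: a \in Phi.
Proof.
move=> aP bP e; have := root_reflection hPhi aP bP.
by rewrite /reflection e mulzK // gt_eqF // dot_gt0.
Qed.

Lemma root_opp a : a \in Phi -> - a \in Phi.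
Proof.
by move=> aP; have := root_refl aP aP (erefl (2 * dot a a)); rewrite scaler_nat mulr2n opprD addNKr.
Qed.

(** Strict Cauchy-Schwarz bounds the product of the two negative Cartan integers below 4, so one of
    them is -1 and its reflection gives the sum. Reducedness settles the proportional case. *)
Lemma root_add a b : a \in Phi -> b \in Phi -> dot a b < 0 -> a != - b -> a + b \in Phi.
Proof.
move=> aP bP ab0 ne; have [p hp] := cartan_int aP bP; have [q hq] := cartan_int bP aP.
rewrite [dot b a]dotC in hq; have a0 := dot_gt0 aP; have b0 := dot_gt0 bP.
have lt : dot a b ^+ 2 < dot a a * dot b b.
  apply: dot_CS_lt => //; apply/eqP => e.
  have a1 : dot a a != 0 by rewrite gt_eqF.
  have [ba|ba] := root_reduced hPhi aP bP a1 e.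
    by rewrite ba ltNge ltW in ab0.
  by rewrite ba opprK eqxx in ne.
have p0 : p < 0 by rewrite -(pmulr_llt0 _ a0) -hp pmulr_rlt0.
have q0 : q < 0 by rewrite -(pmulr_llt0 _ b0) -hq pmulr_rlt0.
have pq : p * q < 4.
  rewrite -(ltr_pM2r (mulr_gt0 a0 b0)).
  have -> : p * q * (dot a a * dot b b) = 4 * dot a b ^+ 2.
    by transitivity ((p * dot a a) * (q * dot b b)); [ring | rewrite -hp -hq; ring].
  by rewrite ltr_pM2l.
have [p1|q1] : p = -1 \/ q = -1 by nia.
  by have := root_refl aP bP hp; rewrite p1 scaleN1r opprK addrC.
by have := root_refl bP aP; rewrite dotC => /(_ _ hq); rewrite q1 scaleN1r opprK.
Qed.

(** Otherwise [alpha i - alpha j] would be a root with coefficients of both signs. *)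
Lemma dot_simple_le0 i j : i != j -> G i j <= 0.
Proof.
move=> ij; rewrite leNgt -dot_alpha; apply/negP => pos.
have aP k := root_simple hPhi k.
have : alpha i - alpha j \in Phi.
  apply: root_add; rewrite ?root_opp ?dotNr ?oppr_lt0 ?opprK //.
  by apply/eqP => /rowP /(_ i); rewrite !alphaE eqxx eq_sym (negPf ij).
have E k : (alpha i - alpha j) 0 k = (i == k)%:R - (j == k)%:R.
  by rewrite mxE [(- alpha j) _ _]mxE !alphaE.
case/(root_base hPhi) => [/(_ j)|/(_ i)]; rewrite E eqxx ?(negPf ij) //.
by rewrite eq_sym (negPf ij).
Qed.

Lemma root_norm_ge2 a : a \in Phi -> 2 <= dot a a.
Proof. by have [_ h] := root_short hPhi; exact: h. Qed.

(* Those roots that are not orthogonal to all short roots form a component. *)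
Lemma exists_short_neighbour b : b \in Phi ->
  exists e, [/\ e \in Phi, dot e e = 2 & dot e b != 0].
Proof.
pose near b := has (fun e => (dot e e == 2) && (dot e b != 0)) Phi.
move=> bP; suff: near b.
  by case/hasP => e eP /andP[/eqP e2 eb]; exists e.
pose A := [fset a in Phi | near a]%fset; pose A' := [fset a in Phi | ~~ near a]%fset.
have [_ irr] := root_irreducible hPhi.
have PhiE : Phi = (A `|` A')%fset.
  apply/fsetP => a; rewrite !inE -andb_orr.
  by rewrite orbN andbT.
have ortho a c : a \in A -> c \in A' -> dot a c = 0.
  rewrite !inE => /andP[aP /hasP[e eP /andP[/eqP e2 ea]]] /andP[cP].
  move/hasPn => h; have ec : dot e c = 0.
    by have := h e eP; rewrite e2 eqxx /= negbK => /eqP.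
  have [k hk] := cartan_int aP eP.
  (* The reflection [f] of [e] in [a] is again short; its orthogonality to [c] yields
     [k * dot a c = 0] with [k] nonzero. *)
  have fP := root_refl aP eP hk; set f := e - k *: a in fP.
  have f2 : dot f f = 2.
    rewrite /f dotDl !dotDr !dotNl !dotNr !dotZl !dotZr [dot e a]dotC e2.
    transitivity (2 - k * (2 * dot a e) + k * (k * dot a a)); first ring.
    by rewrite hk subrK.
  have := h f fP; rewrite f2 eqxx /= negbK /f dotDl dotNl dotZl ec add0r oppr_eq0.
  rewrite mulf_eq0 => /orP[/eqP k0|/eqP //].
  by move: hk ea; rewrite k0 mul0r dotC => /eqP; rewrite mulf_eq0 /= => ->.
have [e eP e2] := (root_short hPhi).1.
(* [A] is not empty: a short root has product 2 with itself. *)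
case: (irr A A' PhiE ortho) => [A0|A'0]; last first.
  by move: bP; rewrite PhiE A'0 fsetU0 inE => /andP[].
have : e \in A by rewrite !inE eP /=; apply/hasP; exists e; rewrite ?e2.
by rewrite A0 inE.
Qed.

(** Let [e] be a short root not orthogonal to [b]. If [dot b b] were odd, integrality would make
    [dot e b] a nonzero multiple of it, and Cauchy-Schwarz would force [dot b b <= 2], against
    oddness and the lower bound 2. *)
Lemma root_norm_even b : b \in Phi -> exists2 m, 0 < m & dot b b = 2 * m.
Proof.
move=> bP; have [e [eP e2 eb]] := exists_short_neighbour bP.
have [k hk] := cartan_int bP eP; rewrite [dot b e]dotC in hk.
have := dot_CS b eP; rewrite e2 => cs.
have b2 := root_norm_ge2 bP.
have [[m hm]|[m hm]] : (exists m, dot b b = 2 * m) \/ (exists m, dot b b = 2 * m + 1).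
  have := divz_eq (dot b b) 2; have := modz_ge0 (dot b b) (isT : 2 != 0 :> int).
  have := ltz_pmod (dot b b) (isT : 0 < 2 :> int).
  set r := (_ %% _)%Z; set q := (_ %/ _)%Z => r2 r0 ->.
  have [->|->] : r = 0 \/ r = 1 by lia.
    by left; exists q; ring.
  by right; exists q; ring.
  by exists m => //; lia.
exfalso; rewrite hm in hk cs b2.
have ke : exists l, k = 2 * l by exists (dot e b - k * m); lia.
case: ke => l kl; rewrite {}kl in hk.
have dl : dot e b = l * (2 * m + 1) by lia.
rewrite {}dl in cs eb.
have l0 : l != 0 by apply: contraNneq eb => ->; rewrite mul0r.
have l2 : 1 <= l ^+ 2 by nia.
have : (2 * m + 1) ^+ 2 <= 2 * (2 * m + 1) by nia.
nia.
Qed.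

Lemma gram_even i : exists2 m, 0 < m & G i i = 2 * m.
Proof. by rewrite -dot_alpha; exact/root_norm_even/(root_simple hPhi). Qed.

Lemma dnum_gt0 i : 0 < dnum G i.
Proof.
by have [m m0 hm] := gram_even i; rewrite /dnum dot_alpha hm mulrC mulzK.
Qed.

Lemma dnumE i : G i i = 2 * dnum G i.
Proof.
by have [m m0 hm] := gram_even i; rewrite /dnum dot_alpha hm [2 * m]mulrC mulzK // mulrC.
Qed.

Lemma dnum_cartan i j : dnum G i * cartan G i j = G i j.
Proof.
have [k hk] := cartan_int (root_simple hPhi i) (root_simple hPhi j).
have G0 : G i i != 0 by rewrite dnumE mulf_neq0 // gt_eqF // dnum_gt0.
rewrite !dot_alpha in hk; rewrite /cartan !dot_alpha hk mulzK //.
by apply: (mulfI (isT : 2 != 0 :> int)); rewrite hk dnumE; ring.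
Qed.

(* The two leaves of the fork of [D_n] are orthogonal, as the values [-1] and [1]
   of the Euler form on them require. *)
Lemma gram_D_fork (i j : 'I_n) :
  (i.+2 == n)%N -> (j.+1 == n)%N -> gram_D n i j = 0.
Proof.
move=> /eqP i2 /eqP j1; rewrite /gram_D mxE.
have ltj : (i.+1 < n)%N by lia.
have ltjF : (j.+1 < n)%N = false by lia.
have ij : j != i by rewrite -val_eqE /=; lia.
rewrite (bigD1 i) //= (bigD1 j) //= big1 => [|k /andP[ki kj]]; last first.
  have kji : (k == i.+1 :> nat) = false.
    by apply/eqP => e; case/eqP: kj; apply: val_inj; rewrite /=; lia.
  by rewrite !mxE ltj (negPf ki) kji subrr mul0r.
rewrite !mxE ltj ltjF eqxx (negPf ij).
have -> : (i.+2 == n)%N by lia.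
have -> : (j.+1 == n)%N by lia.
have -> : (i.+1 == n)%N = false by lia.
have -> : (j.+2 == n)%N = false by lia.
have -> : (i == i.+1 :> nat) = false by lia.
have -> : (j == i.+1 :> nat) by lia.
by [].
Qed.

(** Each off-diagonal entry of [G] is taken up by one order of the indices, and the diagonal is
    halved; on the fork of [D_n] the values -1 and 1 cancel. *)
Lemma euler_simple_sym i j : euler_simple G i j + euler_simple G j i = G i j.
Proof.
have sym k l : G k l = G l k by rewrite -!dot_alpha dotC.
have fork (k l : 'I_n) : [&& (4 <= n)%N && (G == gram_D n), (k.+2 == n)%N & (l.+1 == n)%N] ->
    euler_simple G k l + euler_simple G l k = G k l.
  move=> h; have /and3P[/andP[_ /eqP GD] k2 l1] := h.
  have kF : (k.+1 == n)%N = false by move/eqP: k2; lia.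
  rewrite /euler_simple h kF !andbF [(l.+1 == n)%N && _]andbC h /= addNr.
  by rewrite GD gram_D_fork.
have [/fork//|nij] := boolP [&& (4 <= n)%N && (G == gram_D n), (i.+2 == n)%N & (j.+1 == n)%N].
have [/fork|nji] := boolP [&& (4 <= n)%N && (G == gram_D n), (j.+2 == n)%N & (i.+1 == n)%N].
  by rewrite addrC sym.
rewrite /euler_simple (negPf nij) (negPf nji) [(i.+1 == n)%N && _]andbC (negPf nji).
rewrite [(j.+1 == n)%N && _]andbC (negPf nij) !dnum_cartan [j == i]eq_sym -!(inj_eq val_inj).
have [ij|ji|ij] := ltngtP (val i) (val j).
- by rewrite addr0.
- by rewrite add0r sym.
- by rewrite (val_inj ij) dnumE mulr2n mulrDl mul1r.
Qed.

Lemma euler_sym a b : euler G a b + euler G b a = dot a b.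
Proof.
rewrite -[euler G a b]/(form (euler_simple G) a b) -[euler G b a]/(form (euler_simple G) b a).
rewrite [X in _ + X]formC form_add; apply: eq_form => i j; exact: euler_simple_sym.
Qed.

Lemma euler_diag i : euler G (alpha i) (alpha i) = dnum G i.
Proof.
by have := euler_sym (alpha i) (alpha i); rewrite dot_alpha dnumE; lia.
Qed.

(** The Cartan integer [p] of [g - alpha j] against [alpha j] is nonnegative, else adding [alpha j]
    would give the root [g]; the condition at [i] rules out [g = 0]. The reflection of a nonroot is
    a nonroot because reflections are involutions. *)
Lemma root_reflect_nonroot (g : Q) i j : j != i -> g 0 i = 1 ->
  g - alpha j \in Phi -> g \notin Phi ->
  exists k : nat, [/\ (0 < k)%N, g - alpha j *+ k \notin Phi &
    2 * dot g (alpha j) = k%:Z * dot (alpha j) (alpha j)].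
Proof.
move=> ji gi dP gP; have jP := root_simple hPhi j.
have [p hp] := cartan_int jP dP; have j0 := dot_gt0 jP.
have p0 : 0 <= p.
  rewrite leNgt; apply/negP => p0; case/negP: gP.
  have -> : g = g - alpha j + alpha j by rewrite subrK.
  apply: root_add => //; first by rewrite dotC; nia.
  apply/eqP => /rowP /(_ i); rewrite mxE [(- alpha j) _ _]mxE alphaE gi.
  by rewrite (negPf ji).
(* Passing from [g - alpha j] to [g] raises the Cartan integer by 2. *)
exists (`|p| + 2)%N; have kE : (`|p| + 2)%N%:Z = p + 2 by lia.
have hk : 2 * dot g (alpha j) = (p + 2) * dot (alpha j) (alpha j).
  by move: hp; rewrite dotDr dotNr [dot _ g]dotC; lia.
split; [by lia | | by rewrite kE].
have -> : alpha j *+ (`|p| + 2) = (p + 2) *: alpha j by rewrite -kE -scaler_nat natz.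
apply: contra gP => gP.
have e : 2 * dot (alpha j) (g - (p + 2) *: alpha j) = - (p + 2) * dot (alpha j) (alpha j).
  by rewrite dotDr dotNr dotZr [dot _ g]dotC mulrBr hk; ring.
by have := root_refl jP gP e; rewrite scaleNr opprK subrK.
Qed.

(** * The two-parameter pairing on the root lattice *)

Section Omega.
Variables (K : fieldType) (r s : K).
Hypotheses (r0 : r != 0) (s0 : s != 0).
Hypothesis rs_free : forall k, (0 < k)%N -> r ^+ k != s ^+ k.

Definition omega a b : K := r ^ euler G a b * s ^ (- euler G b a).

Lemma omegaDl a b c : omega (a + b) c = omega a c * omega b c.
Proof.
rewrite /omega (formDl _ a b c : euler G (a + b) c = _).
rewrite (formDr _ c a b : euler G c (a + b) = _) opprD.
by rewrite !expfzDr ?r0 ?s0 // mulrACA.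
Qed.

Lemma omegaDr a b c : omega a (b + c) = omega a b * omega a c.
Proof.
rewrite /omega (formDr _ a b c : euler G a (b + c) = _).
rewrite (formDl _ b c a : euler G (b + c) a = _) opprD.
by rewrite !expfzDr ?r0 ?s0 // mulrACA.
Qed.

Lemma omega_neq0 a b : omega a b != 0.
Proof. by rewrite mulf_neq0 // expfz_neq0 ?r0 ?s0. Qed.

Lemma omega_sym a b : omega a b * omega b a = r ^ dot a b * s ^ (- dot a b).
Proof.
rewrite /omega mulrACA -!expfzDr ?r0 ?s0 //.
by rewrite -opprD euler_sym [euler G b a + _]addrC euler_sym.
Qed.

Lemma omega_diag i :
  omega (alpha i) (alpha i) = r ^ dnum G i * s ^ (- dnum G i).
Proof. by rewrite /omega euler_diag. Qed.

(** Symmetrized, the pairing is a power of [r / s]; both sides have exponent [dnum G j * k]. *)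
Lemma omega_sym_root a j k : 2 * dot a (alpha j) = k * dot (alpha j) (alpha j) ->
  omega a (alpha j) * omega (alpha j) a = omega (alpha j) (alpha j) ^ k.
Proof.
rewrite dot_alpha dnumE => e.
have {}e : dot a (alpha j) = dnum G j * k by lia.
by rewrite omega_sym omega_diag e expfzMl !exprz_exp mulNr.
Qed.

Lemma omega_diag_unity i m : (0 < m)%N -> omega (alpha i) (alpha i) ^+ m != 1.
Proof.
move=> m0; rewrite omega_diag; have := dnum_gt0 i; case: (dnum G i) => // d d0.
rewrite -invr_expz -!exprnP -exprVn -exprMn -exprM.
set k := (d * m)%N; have k0 : (0 < k)%N by rewrite muln_gt0 m0 andbT -ltz_nat.
apply: contra_neq (rs_free k0) => e.
apply: (mulIf (invr_neq0 (expf_neq0 k s0))).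
by rewrite mulfV ?expf_neq0 // -[RHS]e exprMn exprVn.
Qed.

(** The witness is [- a_ij], nonnegative because distinct simple roots have nonpositive product. *)
Lemma omega_serre i j : i != j -> exists N : nat,
  omega (alpha j) (alpha i) * omega (alpha i) (alpha j)
  * omega (alpha i) (alpha i) ^+ N = 1.
Proof.
move=> ij; have [iP jP] := (root_simple hPhi i, root_simple hPhi j).
have [p hp] := cartan_int iP jP; rewrite dotC in hp.
have p0 : p <= 0.
  by have := dot_simple_le0 ij; have := dot_gt0 iP; rewrite -dot_alpha dotC; nia.
exists `|p|%N; rewrite (omega_sym_root hp) exprnP -expfzDr ?omega_neq0 //.
by have -> : p + `|p|%N = 0 by lia.
Qed.

End Omega.

End RootSystem.

(** * Scalars *)

Lemma frac_decomp (D : idomainType) (f : {fraction D}) :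
  exists p q : D, q != 0 /\ f = FracField.tofrac p / FracField.tofrac q.
Proof.
pose g := repr f; exists \n_g, \d_g; have d0 := denom_ratioP g; split=> //.
have d0' : FracField.tofrac \d_g != 0 by rewrite tofrac_eq0.
apply: (mulIf d0'); rewrite divfK //.
unlock FracField.tofrac; rewrite -{1}[f]reprK -[LHS]FracField.pi_mul.
apply/eqmodP; rewrite /= FracField.equivfE /FracField.mulf /=.
by rewrite !numden_Ratio ?oner_neq0 ?mulr1 // mulrC.
Qed.

Section Swap.
Variable R : realType.
Local Notation "x %:F" := (FracField.tofrac x).
Local Notation S := (scalars R).

Lemma rvar_neq0 : rvar R != 0.
Proof. by rewrite /rvar tofrac_eq0 polyC_eq0 polyX_eq0. Qed.

Lemma svar_neq0 : svar R != 0.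
Proof. by rewrite /svar tofrac_eq0 polyX_eq0. Qed.

(** In the outer variable [r ^ k] is constant while [s ^ k] has degree [k]. *)
Lemma rvar_svar_free k : (0 < k)%N -> rvar R ^+ k != svar R ^+ k.
Proof.
move=> k0; rewrite /rvar /svar -!tofracXn tofrac_eq -polyC_exp.
apply/eqP => /(congr1 (fun p : {poly {poly R[i]}} => size p)).
by rewrite size_polyXn => e; have := size_polyC_leq1 ('X^k : {poly R[i]}); rewrite e; lia.
Qed.

Lemma swap_tofrac (p : {poly {poly R[i]}}) : swap_rs (p%:F : S) = (swapXY p)%:F.
Proof.
have := @swap_rsE R p 1 (oner_neq0 _).
by rewrite tofrac1 divr1 rmorph1 tofrac1 divr1.
Qed.

Lemma swap_rsD : {morph @swap_rs R : x y / x + y}.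
Proof.
move=> x y; have [p [q [q0 ->]]] := frac_decomp x; have [p' [q' [q'0 ->]]] := frac_decomp y.
have sq0 u : u != 0 -> (swapXY u)%:F != 0 :> S by rewrite tofrac_eq0 swapXY_eq0.
have Fq0 u : u != 0 -> u%:F != 0 :> S by rewrite tofrac_eq0.
rewrite addf_div ?Fq0 // -!tofracM -tofracD !swap_rsE ?mulf_neq0 //.
by rewrite addf_div ?sq0 // !(rmorphD, rmorphM).
Qed.

Lemma swap_rsM : {morph @swap_rs R : x y / x * y}.
Proof.
move=> x y; have [p [q [q0 ->]]] := frac_decomp x; have [p' [q' [q'0 ->]]] := frac_decomp y.
rewrite mulf_div -!tofracM !swap_rsE ?mulf_neq0 //.
by rewrite mulf_div !rmorphM.
Qed.

Lemma swap_rs1 : swap_rs (1 : S) = 1.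
Proof. by rewrite -{1}tofrac1 swap_tofrac rmorph1 tofrac1. Qed.

Lemma swap_rvar : swap_rs (rvar R) = svar R.
Proof. by rewrite swap_tofrac swapXY_Y. Qed.

Lemma swap_svar : swap_rs (svar R) = rvar R.
Proof. by rewrite swap_tofrac swapXY_X. Qed.

Lemma swap_expz (x : S) (z : int) : x != 0 -> swap_rs (x ^ z) = swap_rs x ^ z.
Proof.
move=> x0; have X m : swap_rs (x ^+ m) = swap_rs x ^+ m.
  by elim: m => [|m IH]; rewrite ?swap_rs1 // !exprS swap_rsM IH.
case: z => m; first exact: X.
have e : swap_rs (x ^+ m.+1)^-1 = (swap_rs (x ^+ m.+1))^-1.
  exact: (sigmaV (@swap_rsM) swap_rs1 (expf_neq0 _ x0)).
by rewrite X in e; exact: e.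
Qed.

(** Exchanging [r] and [s] moves each exponent to the other variable; this is the compatibility that
    makes [bar] multiplicative. *)
Lemma swap_omega n (G : 'M[int]_n) a b :
  swap_rs (omega_pair R G a b) = (omega_pair R G b a)^-1.
Proof.
rewrite /omega_pair swap_rsM (swap_expz _ rvar_neq0) (swap_expz _ svar_neq0).
rewrite swap_rvar swap_svar.
have inv (K : fieldType) (x y : K) (k m : int) : y ^ k * x ^ (- m) = (x ^ m * y ^ (- k))^-1.
  by rewrite invfM !invr_expz opprK mulrC.
exact: inv.
Qed.

End Swap.

Theorem theoremA9 (R : realType) (n : nat)
  (G : 'M[int]_n) (Phi : {fset 'rV[int]_n})
  (hPhi : is_root_system G Phi) (hD : standard_order_D G)
  (leI : rel 'I_n) (hI : total_order leI)
  (B : {malg (scalars R)[seq 'I_n]} -> {malg (scalars R)[seq 'I_n]} -> scalars R)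
  (hB : is_pairing (omega_pair R G) B)
  (l l1 : seq 'I_n) (i : 'I_n)
  (hdom : dominant (omega_pair R G) leI l) (hlyn : lyndon leI l)
  (hfirst : forall (a : 'I_n) (t : seq 'I_n), l = a :: t -> a \notin t)
  (hsize : (1 < size l)%N) (hfact : costandard leI l = (l1, [:: i]))
  (hp : is_string_length Phi (wt l1) (alpha i) 0) :
  B (Rw (omega_pair R G) leI l)
    (bar (omega_pair R G) (@swap_rs R) (Rw (omega_pair R G) leI l))
  = ((omega_pair R G (wt l1) (alpha i))^-1 - omega_pair R G (alpha i) (wt l1))
    * B (Rw (omega_pair R G) leI l1)
        (bar (omega_pair R G) (@swap_rs R) (Rw (omega_pair R G) leI l1)).
Proof.
pose r0 := rvar_neq0 R; pose s0 := svar_neq0 R.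
have cDl : forall a b c, omega_pair R G (a + b) c = omega_pair R G a c * omega_pair R G b c.
  exact: omegaDl r0 s0.
have cDr : forall a b c, omega_pair R G a (b + c) = omega_pair R G a b * omega_pair R G a c.
  exact: omegaDr r0 s0.
have c0 : forall a b, omega_pair R G a b != 0 by exact: omega_neq0 r0 s0.
case: l hlyn hfirst hsize hfact hdom => [|a t'] // hlyn hfirst hsize hfact _.
have at' := hfirst a t' erefl.
have lt := lyndon_min hlyn at'.
case/lastP: t' at' lt hsize hfact {hlyn hfirst} => [|t j] // at' lt _.
rewrite costandard_rcons // => -[e1 e2]; subst l1 j.
have lt1 b : b \in t -> (a != b) && leI a b.
  by move=> bt; apply: lt; rewrite mem_rcons inE bt orbT.
rewrite !(Rw_adw cDl c0) // adw_rcons.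
have ia : i != a by apply: contraNneq at' => <-; rewrite mem_rcons inE eqxx.
have serre k j : k != j -> adnil (omega_pair R G) k (word (scalars R) [:: j]).
  move=> kj; have [N hN] := omega_serre hPhi r0 s0 kj.
  exact: (adnil_letter cDl cDr c0 kj hN).
have adj : adjoint (omega_pair R G) a (wt (a :: t)) (adw (omega_pair R G) a t).
  split.
  - exact: (hom_adw cDl c0).
  - rewrite wt_count /= eqxx (count_memPn _) //.
    by apply: contra at'; rewrite mem_rcons inE => ->; rewrite orbT.
  - by move=> j ja; exact: (dell_adw cDl cDr c0).
  - by move=> j ja; exact: (adnil_adw cDl cDr c0 serre).
apply: (pairing_ad cDl cDr c0 hB (@swap_rsD R) (@swap_rsM R) (swap_rs1 R)) => //.
  by move=> b c; exact: swap_omega.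
(* What remains is that [delr i] kills [R_l1]; the image has weight [|l1| - alpha_i], which is not a
   root. *)
apply: (adjoint_eq0 cDl cDr c0 (Phi := mem Phi)) (adjoint_delr cDl cDr c0 ia adj) _.
- exact: root_simple hPhi.
- by move=> j m; exact: (omega_diag_unity hPhi s0 (@rvar_svar_free R)).
- move=> g b j jb gb gj gP; have [k [k0 kP hk]] := root_reflect_nonroot hPhi jb gb gj gP.
  by exists k; split=> //; rewrite exprnP; exact: (omega_sym_root hPhi r0 s0).
(* String length 0 excludes [m = 1]. *)
- by apply/negP => h; have := hp.2 1%N h.
Qed.
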